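(* Fix $k,\ell\in\mathbb N$ with $\gcd(k,\ell)=1$. Let $\omega$ be a polynomial of degree $d\ge2$ with integer coefficients. Then for a.e. $c\in\mathbb R$ we have $$\Big\|\sum_{N\le n<2N}e^{i(c-\frac k\ell x)\omega(n)+inx}\Big\|_{L^\infty_x}\lesssim N^{1-\frac1{2^d+1}+},\qquad N\in\mathbb N.$$
   Context: $A\lesssim N^{s+}$ means: for every $\epsilon>0$ there is a constant $C$ (which may depend on $\epsilon,c,k,\ell,\omega$ but not on $N$) with $A\le CN^{s+\epsilon}$ for all $N\in\mathbb N$. The supremum is over $x\in\mathbb R$. *)

(* Defs.v *)
From mathcomp Require Import all_boot all_order all_algebra.
From mathcomp Require Import all_classical all_reals all_analysis.
From mathcomp Require Import complex.

Set Implicit Arguments.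
Unset Strict Implicit.
Unset Printing Implicit Defensive.

Import Order.TTheory GRing.Theory Num.Theory.

Local Open Scope ring_scope.

Definition expi (R : realType) (t : R) : R[i] := Complex (cos t) (sin t).

Definition dyadic_sum (R : realType) (k l : nat) (omega : {poly int})
    (c : R) (N : nat) (x : R) : R[i] :=
  \sum_(N <= n < 2 * N)
    expi ((c - k%:R / l%:R * x) * (omega.[n%:Z])%:~R + n%:R * x).

(* Supremum over every x : R, not an essential supremum. It is \bar R-valued,
   hence meaningful without a prior boundedness proof. *)
Definition sup_norm (R : realType) (f : R -> R[i]) : \bar R :=
  ereal_sup [set (ComplexField.Normc.normc (f x))%:E | x in [set: R]]%classic.

(* A <~ N^{s+}; here N ranges over the positive integers. *)
Definition lesssim_plus (R : realType) (A : nat -> \bar R) (s : R) : Prop :=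
  forall e : R, 0 < e ->
    exists C : R, forall N : nat, (0 < N)%N ->
      (A N <= (C * (N%:R `^ (s + e)))%:E)%E.

(* Main.v *)
Require Import Defs.
From mathcomp Require Import all_boot all_order all_algebra.
From mathcomp Require Import all_classical all_reals all_analysis.
From mathcomp Require Import complex.
From mathcomp Require Import ring lra zify.
Import Order.TTheory GRing.Theory Num.Theory.
Import numFieldNormedType.Exports.
Local Open Scope ring_scope.
Set Implicit Arguments.
Unset Strict Implicit.
Unset Printing Implicit Defensive.

(** Put [y = c - (k/l) x], so that the phase is [y * omega n + n * (l/k)(c - y)], let
    [s = 1 / (2^d + 1)] and [Q = (1 - s) / 2 = 2^(d-1) s], and approximate [y / 2 pi] by
    [a / q] with [q <= N^(d-Q)] (Dirichlet).

    If [q >= N^Q], Weyl differencing bounds the sum by [N^(1 - Q / 2^(d-1) +)], which is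
    [N^(1-s+)].

    If [q < N^Q], the factor [g n] of the summand with phase [2 pi a omega n / q + n x]
    satisfies [g (n + q) = z * g n] with [z = exp (i q x)], so its partial sums telescope
    to at most [2 q / |1 - z|]; the remaining factor varies slowly and is removed by Abel
    summation.  Up to an integer and a negligible error, [k q x / (2 pi)] is
    [l q c / (2 pi)], whose distance to the integers is at least [q^(-1-)] for almost
    every [c].  This gives [N^(2Q+)], which is [N^(1-s+)] as well. *)

(** The supremum runs over every [x] while only [c] is generic, so no arithmetic condition can be
    imposed on [x] directly. What saves the bound is the relation [k x = l (c - y)]: once [y] is
    close to a rational multiple of 2 pi with small denominator, [x] is tied to [c] up to a small
    error and inherits its genericity.

    The exponent [Q] balances the two cases: 1 - Q / 2^(d-1) and 2 Q agree exactly when Q = 2^(d-1)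
    / (2^d + 1). The limit N^(d-Q) on the denominators serves both: it makes the Weyl term q / N^d
    at most about N^(-Q), and, if be is the error of the approximation, it gives q |be| N^d <= N^Q,
    so that q (1 + |be| N^d), the loss with Abel summation included, is still O(N^Q). *)

Notation normc := ComplexField.Normc.normc.

(** * Elementary bounds for exp(i t) *)

Section ExponentialSums.
Variable R : realType.
Implicit Types (s t x : R) (z w : R[i]).

Lemma expiD s t : expi (s + t) = expi s * expi t.
Proof. by rewrite /expi cosD sinD [sin s * _ + _]addrC. Qed.

Lemma expi0 : expi (0 : R) = 1.
Proof. by rewrite /expi cos0 sin0. Qed.

Lemma normc_ge0 z : 0 <= normc z.
Proof. by case: z => a b; rewrite sqrtr_ge0. Qed.

Lemma normc_sqr z : normc z ^+ 2 = complex.Re z ^+ 2 + complex.Im z ^+ 2.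
Proof. by case: z => a b; rewrite /= sqr_sqrtr // addr_ge0 // sqr_ge0. Qed.

Lemma normc_expi t : normc (expi t) = 1.
Proof. by rewrite /= cos2Dsin2 sqrtr1. Qed.

Lemma normc_Re z : complex.Re z <= normc z.
Proof.
apply: le_trans (ler_norm _) _; rewrite -(@ler_pXn2r _ 2) ?nnegrE ?normc_ge0 //.
by rewrite normc_sqr real_normK ?num_real // lerDl sqr_ge0.
Qed.

Lemma normc_Im z : `|complex.Im z| <= normc z.
Proof.
rewrite -(@ler_pXn2r _ 2) ?nnegrE ?normc_ge0 //.
by rewrite normc_sqr real_normK ?num_real // lerDr sqr_ge0.
Qed.

Lemma normc_leD (z : R[i]) : normc z <= `|complex.Re z| + `|complex.Im z|.
Proof.
rewrite -(@ler_pXn2r _ 2) ?nnegrE ?normc_ge0 ?addr_ge0 //.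
rewrite normc_sqr sqrrD !real_normK ?num_real // -addrA lerD2l lerDr.
by rewrite mulrn_wge0 // mulr_ge0.
Qed.

Lemma normc_sum (I : Type) (r : seq I) (P : pred I) (F : I -> R[i]) :
  normc (\sum_(i <- r | P i) F i) <= \sum_(i <- r | P i) normc (F i).
Proof.
elim/big_ind2: _ => [|z a w b hz hw|//]; first by rewrite ComplexField.Normc.normc0.
exact: le_trans (le_normcD _ _) (lerD hz hw).
Qed.

Lemma expi_int (m : int) : expi (2 * pi * m%:~R) = 1 :> R[i].
Proof.
have h n : expi (2 * pi * n%:R) = 1 :> R[i].

  elim: n => [|n ih]; first by rewrite mulr0 expi0.
  rewrite -(natr1 n) mulrDr expiD ih // mulr1 mul1r mulr_natl.
  by rewrite /expi cos2pi sin2pi.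
case: m => n; first exact: h.
rewrite NegzE mulrNz mulrN; apply: (@mulIf _ (expi (2 * pi * n.+1%:R))).
  by apply/eqP => e; have := h n.+1; rewrite e => /eqP; rewrite eq_sym oner_eq0.
by rewrite -expiD addNr expi0 h mulr1.
Qed.

Lemma expiN_neg t : normc (1 - expi (- t)) = normc (1 - expi t).
Proof.
suff -> : 1 - expi (- t) = - expi (- t) * (1 - expi t).
  by rewrite ComplexField.Normc.normcM normcN normc_expi mul1r.
by rewrite mulNr mulrBr mulr1 -expiD addNr expi0 opprB.
Qed.

(** The mean value theorem is applied to the cosine and the sine separately; adding the two parts
    gives the factor 2. *)
Lemma normc_1Bexpi_le t : normc (1 - expi t) <= 2 * `|t|.
Proof.
suff h x : 0 <= x -> normc (1 - expi x) <= 2 * x.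
  have [t0|t0] := leP 0 t; first by rewrite ger0_norm // h.
  by rewrite -expiN_neg ltr0_norm // h // oppr_ge0 ltW.
rewrite le_eqVlt => /predU1P[<-|x0].
  by rewrite expi0 subrr ComplexField.Normc.normc0 mulr0.
have [|c _ hc] := MVT x0 (fun y _ => @is_derive_cos R y).
  exact/continuous_subspaceT/continuous_cos.
have [|d _ hd] := MVT x0 (fun y _ => @is_derive_sin R y).
  exact/continuous_subspaceT/continuous_sin.
rewrite cos0 sin0 !subr0 in hc hd.
apply: le_trans (normc_leD _) _; rewrite /= -normrN opprB hc sub0r normrN hd.
rewrite !normrM normrN (gtr0_norm x0) -mulrDl ler_pM2r //.
by have := sin_max c; have := cos_max d; lra.
Qed.

Lemma normc_expiB_le s t : normc (expi s - expi t) <= 2 * `|s - t|.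
Proof.
have -> : expi s - expi t = - expi t * (1 - expi (s - t)).
  by rewrite mulNr mulrBr mulr1 -expiD opprB (addrC t) subrK.
by rewrite ComplexField.Normc.normcM normcN normc_expi mul1r normc_1Bexpi_le.
Qed.

(** [eta] stands for any lower bound of the distance from [t] to the integers, so that this distance
    itself never has to be defined. *)
Lemma normc_1Bexpi_ge t (eta : R) :
  (forall m : int, eta <= `|t - m%:~R|) -> eta <= normc (1 - expi (2 * pi * t)).
Proof.
(* If the cosine is at most 1/2, the real part is at least 1/2 >= x. Otherwise the sine equals 2 pi
   x cos c with 0 < c < 2 pi x <= pi, and cos c > 1/2 because the cosine decreases there. *)
have key x : 0 <= x <= 2^-1 -> x <= normc (1 - expi (2 * pi * x)).
  move=> /andP[x0 x1]; have p0 := @pi_gt0 R; have p2 := @pi_ge2 R.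
  have [hc|hc] := leP (cos (2 * pi * x)) 2^-1.
    by apply: le_trans (normc_Re _) => /=; lra.
  move: x0; rewrite le_eqVlt => /predU1P[<-|x0]; first exact: normc_ge0.
  have y0 : 0 < 2 * pi * x by rewrite !mulr_gt0.
  have [|c /itvP hi hd] := MVT y0 (fun y _ => @is_derive_sin R y).
    exact/continuous_subspaceT/continuous_sin.
  apply: le_trans (normc_Im _) => /=; rewrite sub0r normrN.
  apply: le_trans (ler_norm _); rewrite sin0 !subr0 in hd; rewrite hd.
  have ypi : 2 * pi * x <= pi by nra.
  have : cos (2 * pi * x) <= cos c.
    by rewrite le_eqVlt ltr_cos ?hi ?orbT // in_itv /=; rewrite ?(ltW y0) // !hi /= (le_trans _ ypi) ?hi.
  by move=> hcc; nra.
move=> h; pose m := Num.floor t.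
have /andP[m0 m1] : m%:~R <= t < (m + 1)%:~R by rewrite floor_le_tmp ?floorD1_gt.
have E (b : int) : expi (2 * pi * t) = expi (2 * pi * (t - b%:~R)).
  by rewrite mulrBr expiD -mulrN -mulrNz expi_int mulr1.
have [hh|hh] := leP (t - m%:~R) 2^-1.
  rewrite (E m); apply: le_trans (key _ _); last by rewrite hh subr_ge0 m0.
  by apply: le_trans (h m) _; rewrite ger0_norm // subr_ge0.
rewrite (E (m + 1)) -expiN_neg -mulrN; apply: le_trans (key _ _).
  by apply: le_trans (h (m + 1)) _; rewrite ltr0_norm // subr_lt0.
by move: m1; rewrite intrD; lra.
Qed.
End ExponentialSums.

(** * Telescoping, Abel summation and van der Corput's inequality *)

Section SummationTools.
Variable R : realType.
Implicit Types (z w : R[i]) (g u : nat -> R[i]) (f : nat -> R).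

(** Multiplication by 1 - z leaves only a block of [q] terms at each end. The product form covers z
    = 1; it is applied with q = 1 to linear phases and with q a denominator to rational ones. *)
Lemma quasi_periodic_sum g z (q N : nat) :
  (forall n, normc (g n) <= 1) -> (forall n, g (n + q)%N = z * g n) ->
  normc (\sum_(0 <= n < N) g n) * normc (1 - z) <= 2 * q%:R.
Proof.
move=> g1 gq; rewrite -ComplexField.Normc.normcM.
have bnd a L : normc (\sum_(a <= n < a + L) g n) <= L%:R.
  apply: le_trans (normc_sum _ _ _) _; apply: (@le_trans _ _ (\sum_(a <= n < a + L) 1)).
    by apply: ler_sum => n _.
  by rewrite sumr_const_nat addKn.
have -> : (\sum_(0 <= n < N) g n) * (1 - z) =
    \sum_(0 <= n < 0 + q) g n - \sum_(N <= n < N + q) g n.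
  have e : \sum_(0 <= n < N + q) g n =
      \sum_(0 <= n < q) g n + z * \sum_(0 <= n < N) g n.
    rewrite (@big_cat_nat _ _ _ q) ?leq_addl //= -{2}[q]add0n big_addn addnK big_distrr /=.
    by congr (_ + _); apply: eq_bigr => n _; rewrite gq.
  have := e; rewrite (@big_cat_nat _ _ _ N) ?leq_addr //= add0n => /eqP.
  rewrite mulrBr mulr1 (mulrC z) => /eqP h.
  by apply/eqP; rewrite subr_eq addrAC -h addrK.
apply: le_trans (le_normcD _ _) _; rewrite normcN mulr_natl mulr2n.
by rewrite lerD.
Qed.

Lemma Abel_sum_le g (w : nat -> R[i]) (B V : R) (N : nat) :
  0 <= B -> (forall n, normc (w n) <= 1) ->
  (forall t, normc (\sum_(0 <= n < t) g n) <= B) ->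
  \sum_(0 <= n < N) normc (w n.+1 - w n) <= V ->
  normc (\sum_(0 <= n < N) g n * w n) <= B * (1 + V).
Proof.
move=> B0 w1 gB wV.
have -> : \sum_(0 <= n < N) g n * w n = (\sum_(0 <= n < N) g n) * w N
    - \sum_(0 <= n < N) (\sum_(0 <= m < n.+1) g m) * (w n.+1 - w n).
  elim: N {wV} => [|N ih]; first by rewrite !big_geq // mul0r subr0.
  rewrite !(big_nat_recr N) //= ih; ring.
apply: le_trans (le_normcD _ _) _; rewrite normcN ComplexField.Normc.normcM mulrDr mulr1.
apply: lerD; first by rewrite -[leRHS]mulr1 ler_pM ?normc_ge0.
apply: le_trans (normc_sum _ _ _) _; apply: le_trans (ler_wpM2l B0 wV).
rewrite big_distrr /=; apply: ler_sum => n _.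
by rewrite ComplexField.Normc.normcM ler_wpM2r ?normc_ge0.
Qed.

Definition expsum f (L : nat) : R := normc (\sum_(0 <= n < L) expi (f n)).

Lemma expsum_ge0 f L : 0 <= expsum f L.
Proof. exact: normc_ge0. Qed.

Lemma expsum_le f L : expsum f L <= L%:R.
Proof.
apply: le_trans (normc_sum _ _ _) _.
by under eq_bigr do rewrite normc_expi; rewrite sumr_const_nat subn0.
Qed.

Lemma Re_sum_expi f (L : nat) :
  complex.Re (\sum_(0 <= n < L) expi (f n)) = \sum_(0 <= n < L) cos (f n).
Proof. exact: (big_morph (fun z : R[i] => complex.Re z) (fun x y => raddfD _ x y) (raddf0 _)). Qed.

Lemma Im_sum_expi f (L : nat) :
  complex.Im (\sum_(0 <= n < L) expi (f n)) = \sum_(0 <= n < L) sin (f n).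
Proof. exact: (big_morph (fun z : R[i] => complex.Im z) (fun x y => raddfD _ x y) (raddf0 _)). Qed.

(** Ordered pairs of distinct indices are grouped by their difference h; a pair and its mirror image
    contribute twice a cosine. *)
Lemma expsum_sqr f L : expsum f L ^+ 2 = L%:R + 2 * \sum_(1 <= h < L)
  \sum_(0 <= n < L - h) cos (f (n + h)%N - f n).
Proof.
rewrite normc_sqr Re_sum_expi Im_sum_expi; elim: L => [|L ih].
  by rewrite !big_geq // !expr0n /= !mulr0 !addr0.
rewrite [\sum_(0 <= n < L.+1) cos _]big_nat_recr //= [\sum_(0 <= n < L.+1) sin _]big_nat_recr //=.
(* The new pairs are those that contain the index [L], exactly one for each difference h. *)
have -> : \sum_(1 <= h < L.+1) \sum_(0 <= n < L.+1 - h) cos (f (n + h)%N - f n)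
   = \sum_(1 <= h < L) \sum_(0 <= n < L - h) cos (f (n + h)%N - f n)
     + \sum_(0 <= n < L) cos (f L - f n).
  have -> : \sum_(1 <= h < L) \sum_(0 <= n < L - h) cos (f (n + h)%N - f n) =
     \sum_(1 <= h < L.+1) \sum_(0 <= n < L - h) cos (f (n + h)%N - f n).
    case: L {ih} => [|L]; first by rewrite !big_geq.
    by rewrite [RHS]big_nat_recr //= subnn [X in _ + X]big_geq // addr0.
  have -> : \sum_(0 <= n < L) cos (f L - f n)
      = \sum_(1 <= h < L.+1) cos (f L - f (L - h)%N).
    rewrite big_add1 /= big_nat_rev /=; apply: eq_big_nat => n /andP[_ nL].
    by rewrite add0n.
  rewrite -big_split /=; apply: eq_big_nat => h /andP[h0 hL].
  by rewrite subSn // big_nat_recr //= subnK.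
rewrite mulrDr addrA -natr1.
have -> : \sum_(0 <= n < L) cos (f L - f n)
   = cos (f L) * \sum_(0 <= n < L) cos (f n) + sin (f L) * \sum_(0 <= n < L) sin (f n).
  by rewrite !big_distrr -big_split /=; apply: eq_bigr => n _; rewrite cosB.
have := cos2Dsin2 (f L); move: ih; set C := \sum_(0 <= n < L) cos (f n).
set S := \sum_(0 <= n < L) sin (f n); set X := \sum_(1 <= h < L) _.
by move=> ih e; rewrite !sqrrD; lra.
Qed.

Lemma van_der_Corput f L : expsum f L ^+ 2 <= L%:R +
  2 * \sum_(1 <= h < L) expsum (fun n => f (n + h)%N - f n) (L - h).
Proof.
rewrite expsum_sqr lerD2l ler_wpM2l //; apply: ler_sum => h _.
by rewrite -Re_sum_expi normc_Re.
Qed.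

End SummationTools.

(** * Weyl differencing *)

Section WeylInequality.
Variable R : realType.

(* [N * kap N t] plays the role of [min (N, 1 / ||t||)] without a division by zero at integers. *)
Definition kap (N : nat) (t : R) : R := (1 + N%:R * normc (1 - expi (2 * pi * t)))^-1.

Lemma kap_ge0 N t : 0 <= kap N t.
Proof. by rewrite invr_ge0 addr_ge0 // mulr_ge0 // normc_ge0. Qed.

(** After multiplication by the denominator of [kap], the trivial bound contributes N and the
    geometric sum 2 N, hence the 3. *)
Lemma expsum_linear (f : nat -> R) (a b : R) (L N : nat) : (L <= N)%N ->
  (forall n, f n = 2 * pi * (a * n%:R + b)) -> expsum f L <= 3 * N%:R * kap N a.
Proof.
move=> LN hf; rewrite ler_pdivlMr; last first.
  by rewrite ltr_pwDl // mulr_ge0 // normc_ge0.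
have h : expsum f L * normc (1 - expi (2 * pi * a)) <= 2 * 1%:R.
  apply: quasi_periodic_sum => [n|n]; first by rewrite normc_expi.
  by rewrite -expiD !hf natrD; congr expi; ring.
rewrite mulrDr mulr1 mulrCA (_ : 3 * N%:R = N%:R + N%:R * 2); last by ring.
apply: lerD; first by apply: le_trans (expsum_le _ _) _; rewrite ler_nat.
by apply: ler_wpM2l => //; rewrite mulr1 in h.
Qed.

(** This is N^(-j) times the sum of kap N (h_1 ... h_j a) over all 1 <= h_i < N: what remains after
    j differencings, when the phase has become linear. *)
Fixpoint weyl_mean (j N : nat) (a : R) : R :=
  if j is i.+1 then N%:R^-1 * \sum_(1 <= h < N) weyl_mean i N (h%:R * a) else kap N a.

Lemma weyl_mean_ge0 j N a : 0 <= weyl_mean j N a.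
Proof.
elim: j a => [|j ih] a /=; first exact: kap_ge0.
by rewrite mulr_ge0 ?invr_ge0 // sumr_ge0.
Qed.

(** Cauchy-Schwarz applied j times. Only N - 1 terms are divided by N; the missing one counts as
    zero. *)
Lemma mean_expn_le (y : nat -> R) (j N : nat) : (0 < N)%N -> (forall h, 0 <= y h) ->
  (N%:R^-1 * \sum_(1 <= h < N) y h) ^+ (2 ^ j) <= N%:R^-1 * \sum_(1 <= h < N) y h ^+ (2 ^ j).
Proof.
move=> N0; elim: j y => [|j ih] y y0; first by under [X in _ <= _ * X]eq_bigr do rewrite expr1.
have h2 (x : nat -> R) : (N%:R^-1 * \sum_(1 <= h < N) x h) ^+ 2 <=
    N%:R^-1 * \sum_(1 <= h < N) x h ^+ 2.
  have [m mE] : exists m, m = N%:R^-1 * \sum_(1 <= h < N) x h by eexists.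
  rewrite -mE.
  have N1 : 0 < N%:R :> R by rewrite ltr0n.
  have : 0 <= N%:R^-1 * \sum_(1 <= h < N) (x h - m) ^+ 2.
    by rewrite mulr_ge0 ?invr_ge0 // sumr_ge0 // => i _; rewrite sqr_ge0.
  have -> : \sum_(1 <= h < N) (x h - m) ^+ 2 =
     \sum_(1 <= h < N) x h ^+ 2 - 2 * m * \sum_(1 <= h < N) x h + (N - 1)%:R * m ^+ 2.
    have -> : (N - 1)%:R * m ^+ 2 = \sum_(1 <= h < N) m ^+ 2.
      by rewrite sumr_const_nat mulr_natl.
    rewrite -mulNr mulr_sumr -[RHS]addrA -big_split /= -big_split /=.
    by apply: eq_bigr => i _; ring.
  have -> : \sum_(1 <= h < N) x h = N%:R * m by rewrite mE mulrA divff ?mul1r ?gt_eqF.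
  rewrite natrB // !mulrDr mulrN.
  have -> : N%:R^-1 * (2 * m * (N%:R * m)) = 2 * m ^+ 2 by field; rewrite gt_eqF.
  have -> : N%:R^-1 * ((N%:R - 1%:R) * m ^+ 2) = m ^+ 2 - N%:R^-1 * m ^+ 2.
    by field; rewrite gt_eqF.
  have : 0 <= N%:R^-1 * m ^+ 2 by rewrite mulr_ge0 ?invr_ge0 ?sqr_ge0.
  lra.
rewrite expnS exprM.
under [X in _ <= _ * X]eq_bigr do rewrite exprM.
apply: le_trans (ih _ (fun h => sqr_ge0 _)).
apply: lerXn2r; rewrite ?nnegrE ?sqr_ge0 //.
by rewrite mulr_ge0 ?invr_ge0 // sumr_ge0 // => i _; rewrite sqr_ge0.
Qed.

Lemma exprD_le2 (a b : R) n : 0 <= a -> 0 <= b ->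
  (a + b) ^+ n <= 2 ^+ n * (a ^+ n + b ^+ n).
Proof.
wlog ab : a b / a <= b.
  move=> H a0 b0; have [h|h] := leP a b; first exact: H.
  by rewrite addrC (addrC (a ^+ n)); apply: H => //; exact: ltW.
move=> a0 b0; apply: (@le_trans _ _ ((2 * b) ^+ n)).
  by apply: lerXn2r; rewrite ?nnegrE ?addr_ge0 ?mulr_ge0 //; lra.
by rewrite exprMn ler_wpM2l ?exprn_ge0 // lerDr exprn_ge0.
Qed.

Definition poly_diff (p : {poly R}) (h : R) : {poly R} := p \Po ('X + h%:P) - p.

Lemma horner_poly_diff p h x : (poly_diff p h).[x] = p.[x + h] - p.[x].
Proof. by rewrite hornerD hornerN horner_comp !hornerE. Qed.

Lemma coef_comp_XaddC (p : {poly R}) h i : (p \Po ('X + h%:P))`_i = p^`N(i).[h].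
Proof.
have [pi|pi] := ltnP i (size p); last first.
  rewrite nderivn_poly0 // horner0 nth_default //.
  by rewrite size_comp_poly2 // size_XaddC.
rewrite /comp_poly addrC nderiv_taylor; last exact: commr_polyX.
rewrite size_map_polyC coef_sum (bigD1 (Ordinal pi)) //= big1 => [|k /negbTE ki].
  by rewrite addr0 nderivn_map horner_map coefCM coefXn eqxx mulr1.
rewrite nderivn_map horner_map coefCM coefXn; move: ki; rewrite -val_eqE /= eq_sym => ->.
by rewrite mulr0.
Qed.

Lemma size_poly_diff (p : {poly R}) h j : (size p <= j.+3)%N -> (size (poly_diff p h) <= j.+2)%N.
Proof.
move=> sp; apply/leq_sizeP => i ji; rewrite coefB coef_comp_XaddC.
rewrite (_ : p^`N(i) = (p`_i)%:P) ?hornerC ?subrr //; apply/polyP => k.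
rewrite coef_nderivn coefC; case: eqP => [->|k0]; first by rewrite addn0 binn.
by rewrite nth_default ?mul0rn //; apply: leq_trans sp _; lia.
Qed.

Lemma coef_poly_diff (p : {poly R}) h j : (size p <= j.+3)%N ->
  (poly_diff p h)`_j.+1 = j.+2%:R * h * p`_j.+2.
Proof.
move=> sp; rewrite coefB coef_comp_XaddC.
have -> : p^`N(j.+1) = (p`_j.+1)%:P + (p`_j.+2 *+ j.+2) *: 'X.
  apply/polyP => -[|[|k]]; rewrite coef_nderivn coefD coefC coefZ coefX /=.
  - by rewrite addn0 binn mulr0 addr0.
  - by rewrite addn1 binSn mulr1 add0r.
  by rewrite nth_default ?mul0rn ?mulr0 ?addr0 //; apply: leq_trans sp _; lia.
by rewrite !hornerE -mulr_natl; ring.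
Qed.

(** [L] is kept apart from [N] because a difference of step h shortens the sum to L - h, while the
    normalisation by N must survive the induction. Each step multiplies the leading coefficient by
    the degree and by h: the degrees build the factorial, the steps h the argument of [kap]. *)
Lemma Weyl_differencing (j : nat) : exists2 C : R, 0 <= C &
  forall (N L : nat) (p : {poly R}), (0 < N)%N -> (L <= N)%N -> (size p <= j.+2)%N ->
  (expsum (fun n => 2 * pi * p.[n%:R]) L / N%:R) ^+ (2 ^ j) <=
    C * (N%:R^-1 + weyl_mean j N (j.+1`!%:R * p`_j.+1)).
Proof.
elim: j => [|j [C C0 ih]].
  exists 3 => // N L p N0 LN sp; have N1 : 0 < N%:R :> R by rewrite ltr0n.
  have hp : p = p`_1 *: 'X + (p`_0)%:P.
    apply/polyP => -[|[|k]]; rewrite coefD coefZ coefX coefC /= ?mulr0 ?mulr1 ?add0r ?addr0 //.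
    by rewrite nth_default //; apply: leq_trans sp _.
  rewrite expr1 ler_pdivrMr //= mul1r.
  have := @expsum_linear (fun n => 2 * pi * p.[n%:R]) p`_1 p`_0 L N LN.
  move=> /(_ _)/le_trans; apply => [n|]; first by rewrite {1}hp !hornerE.
  rewrite -!mulrA ler_pM2l // mulrC ler_pM2r // lerDr invr_ge0 //.
(* One factor 2^(2^j) comes from [exprD_le2], the other from the 2 in [van_der_Corput]. *)
exists (4 ^+ (2 ^ j) * (1 + C)); first by rewrite mulr_ge0 ?exprn_ge0 ?addr_ge0.
move=> N L p N0 LN sp; have N1 : 0 < N%:R :> R by rewrite ltr0n.
set f := fun n => _; pose y h := expsum (fun n => 2 * pi * (poly_diff p h%:R).[n%:R]) (L - h) / N%:R.
have y0 h : 0 <= y h by rewrite divr_ge0 ?expsum_ge0.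
have step : (expsum f L / N%:R) ^+ 2 <= N%:R^-1 + 2 * (N%:R^-1 * \sum_(1 <= h < N) y h).
  rewrite expr_div_n ler_pdivrMr ?exprn_gt0 //; apply: le_trans (van_der_Corput _ _) _.
  set S := \sum_(1 <= h < N) _.
  have -> : (N%:R^-1 + 2 * (N%:R^-1 * S)) * N%:R ^+ 2 = N%:R + 2 * (S * N%:R).
    by field; rewrite gt_eqF.
  rewrite lerD ?ler_nat // ler_pM2l // /S big_distrl /=.
  under [leRHS]eq_bigr => h _ do rewrite /= divfK ?gt_eqF //.
  case: L {S y y0} LN => [|L] LN; first by rewrite big_geq // sumr_ge0 // => *; exact: expsum_ge0.
  rewrite [leRHS](@big_cat_nat _ _ _ L.+1) //= ler_wpDr //.
    by rewrite sumr_ge0 // => *; exact: expsum_ge0.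
  rewrite le_eqVlt; apply/orP; left; apply/eqP; apply: eq_bigr => h _; congr expsum.
  by apply: funext => n; rewrite /f horner_poly_diff natrD; ring.
rewrite expnS exprM.
apply: le_trans (lerXn2r (2 ^ j) _ _ step) _; rewrite ?nnegrE ?sqr_ge0 //.
  by rewrite addr_ge0 ?mulr_ge0 ?invr_ge0 ?sumr_ge0.
apply: le_trans (exprD_le2 _ _ _) _; rewrite ?invr_ge0 ?mulr_ge0 ?invr_ge0 ?sumr_ge0 //.
rewrite (_ : 4 ^+ (2 ^ j) = 2 ^+ (2 ^ j) * 2 ^+ (2 ^ j)); last by rewrite -exprMn -natrM.
rewrite -[leRHS]mulrA -[leRHS]mulrA ler_wpM2l ?exprn_ge0 //.
have p2 : 1 <= 2 ^+ (2 ^ j) :> R by rewrite exprn_ege1 // ler1n.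
have hN : N%:R^-1 ^+ (2 ^ j) <= N%:R^-1 :> R.
  rewrite -[leRHS]expr1 ler_wiXn2l ?invr_ge0 ?expn_gt0 //.
  by rewrite invf_le1 // ler1n.
have hy : (2 * (N%:R^-1 * \sum_(1 <= h < N) y h)) ^+ (2 ^ j) <=
   2 ^+ (2 ^ j) * (C * (N%:R^-1 + weyl_mean j.+1 N (j.+2`!%:R * p`_j.+2))).
  rewrite exprMn ler_wpM2l ?exprn_ge0 //; apply: le_trans (mean_expn_le _ _ _) _ => //.
  rewrite mulrC ler_pdivrMr //.
  apply: (@le_trans _ _ (\sum_(1 <= h < N)
      C * (N%:R^-1 + weyl_mean j N (h%:R * (j.+2`!%:R * p`_j.+2))))).
    apply: ler_sum => h _.
    have := ih N (L - h)%N (poly_diff p h%:R) N0 (leq_trans (leq_subr _ _) LN) (size_poly_diff _ sp).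
    move/le_trans; apply; rewrite coef_poly_diff // [j.+2`!]factS natrM.
    rewrite le_eqVlt; apply/orP; left; apply/eqP; congr (_ * (_ + weyl_mean _ _ _)); ring.
  rewrite -big_distrr /= -[leRHS]mulrA.
  apply: ler_wpM2l => //; rewrite big_split /= mulrDl lerD //.
    by rewrite sumr_const_nat -[leLHS]mulr_natr ler_wpM2l ?invr_ge0 // ler_nat leq_subr.
  by rewrite mulrAC mulVf ?mul1r // gt_eqF.
have W0 := weyl_mean_ge0 j.+1 N (j.+2`!%:R * p`_j.+2).
set W := weyl_mean _ _ _ in hy W0 *; set E := 2 ^+ (2 ^ j) in p2 hy *.
have Ni : 0 <= N%:R^-1 :> R by rewrite invr_ge0.
apply: (@le_trans _ _ (E * N%:R^-1 + E * (C * (N%:R^-1 + W)))).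
  apply: lerD => //; apply: le_trans hN _; rewrite ler_peMl //.
by rewrite -mulrDr ler_wpM2l ?(le_trans _ p2) // mulrDl mul1r lerD2r lerDl.
Qed.

End WeylInequality.

(** * Sums of [kap] over multiples of a number close to a/q *)

Section SeparatedSums.
Variable R : realType.

Lemma invn_le_lnB n : n.+2%:R^-1 <= ln n.+2%:R - ln n.+1%:R :> R.
Proof.
have h1 : 0 < n.+1%:R :> R by rewrite ltr0n.
have h2 : 0 < n.+2%:R :> R by rewrite ltr0n.
have n2 : n.+2%:R = n.+1%:R + 1 :> R by rewrite natr1.
rewrite -ln_div ?posrE // -[_ / _]invf_div lnV ?posrE ?divr_gt0 // lerNr.
have -> : n.+1%:R / n.+2%:R = 1 + (- n.+2%:R^-1) :> R.
  apply: (mulIf (lt0r_neq0 h2)).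
  by rewrite mulrDl mulNr divfK ?mulVf ?gt_eqF // mul1r n2 addrK.
by apply: le_ln1Dx; rewrite ltrN2 invf_lt1 // ltr1n.
Qed.

Lemma harmonic_le_ln n : (0 < n)%N -> \sum_(1 <= s < n.+1) s%:R^-1 <= 1 + ln n%:R :> R.
Proof.
case: n => // n _; elim: n => [|n ih]; first by rewrite big_nat1 invr1 ln1 addr0.
rewrite big_nat_recr //=; apply: le_trans (lerD ih (lexx _)) _.
by rewrite -addrA lerD2l -lerBrDl invn_le_lnB.
Qed.

Lemma kap_le1 N (t : R) : kap N t <= 1.
Proof. by rewrite invf_le1 ?lerDl ?ltr_pwDl // mulr_ge0 ?normc_ge0. Qed.

Lemma kap_le N (t eta : R) : (0 < N)%N -> 0 < eta ->
  (forall m : int, eta <= `|t - m%:~R|) -> kap N t <= (N%:R * eta)^-1.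
Proof.
move=> N0 e0 h; have N1 : 0 < N%:R :> R by rewrite ltr0n.
rewrite lef_pV2 ?posrE ?mulr_gt0 ?ltr_pwDl ?mulr_ge0 ?normc_ge0 //.
by rewrite ler_wpDl // ler_wpM2l // normc_1Bexpi_ge.
Qed.

(** Since q does not divide m a, the number m a / q is at least 1/q away from every integer, and
    replacing a/q by [al] moves it by at most m / q^2 <= 1 / (2q). *)
Lemma rational_approx_separation (a b : int) (q m : nat) (al : R) : (0 < q)%N -> (0 < m)%N ->
  (m.*2 <= q)%N -> coprime `|a| q -> `|al - a%:~R / q%:R| <= (q%:R ^+ 2)^-1 ->
  (q.*2%:R)^-1 <= `|m%:R * al - b%:~R|.
Proof.
move=> q0 m0 mq aq ha; have q1 : 0 < q%:R :> R by rewrite ltr0n.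
have m1 : 0 < m%:R :> R by rewrite ltr0n.
have hI : 1 <= `|m%:Z * a - b * q%:Z|.
  rewrite -gtz0_ge1 normr_gt0 subr_eq0; apply/negP => /eqP e.
  have : (q %| m * `|a|)%N by apply/dvdnP; exists `|b|%N; rewrite -[m]absz_nat -abszM e abszM absz_nat.
  rewrite Gauss_dvdl 1?coprime_sym // => /dvdn_leq -/(_ m0); lia.
have hq : q%:R^-1 <= `|m%:R * (a%:~R / q%:R) - b%:~R| :> R.
  have -> : m%:R * (a%:~R / q%:R) - b%:~R = (m%:Z * a - b * q%:Z)%:~R / q%:R :> R.
    by rewrite intrB !intrM -!pmulrn; field; rewrite gt_eqF.
  by rewrite normrM normfV (gtr0_norm q1) ler_peMl ?invr_ge0 // -intr_norm ler1z.
have hd : `|m%:R * al - m%:R * (a%:~R / q%:R)| <= (q.*2%:R)^-1.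
  rewrite -mulrBr normrM (gtr0_norm m1); apply: le_trans (ler_wpM2l (ltW m1) ha) _.
  rewrite ler_pdivrMr ?exprn_gt0 //.
  have -> : q.*2%:R^-1 * q%:R ^+ 2 = q%:R / 2 :> R.
    by rewrite -muln2 natrM; field; rewrite gt_eqF.
  by rewrite ler_pdivlMr // -natrM ler_nat muln2.
have h2 : q%:R^-1 = q.*2%:R^-1 + q.*2%:R^-1 :> R.
  by rewrite -muln2 natrM; field; rewrite gt_eqF.
have := ler_normB (m%:R * al - b%:~R) (m%:R * al - m%:R * (a%:~R / q%:R)).
rewrite (_ : _ - _ - (_ - _) = m%:R * (a%:~R / q%:R) - b%:~R); last by ring.
lra.
Qed.

Definition fracpart (x : R) : R := x - (Num.floor x)%:~R.

Lemma fracpart_itv x : 0 <= fracpart x < 1.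
Proof.
have /andP[] : (Num.floor x)%:~R <= x < (Num.floor x + 1)%:~R by rewrite floor_le_tmp ?floorD1_gt.
by rewrite intrD /fracpart; lra.
Qed.

(** Indices in the block differ by at most q/2, so the fractional parts are 1/(2q)-separated and
    each of the 2q cells of length 1/(2q) holds at most one of them ([phi] is the cell number).
    Summing the reciprocal distances of the cells to the integers gives the logarithm. *)
Lemma sum_kap_block (a : int) (q N m0 : nat) (al : R) : (0 < q)%N -> (0 < N)%N ->
  coprime `|a| q -> `|al - a%:~R / q%:R| <= (q%:R ^+ 2)^-1 ->
  \sum_(0 <= i < q./2.+1) kap N ((m0 + i)%:R * al) <=
    2 + 4 * (q%:R / N%:R) * (1 + ln (q.*2%:R)).
Proof.
move=> q0 N0 aq ha; have q1 : 0 < q%:R :> R by rewrite ltr0n.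
have N1 : 0 < N%:R :> R by rewrite ltr0n.
have qq : 0 < q.*2%:R :> R by rewrite ltr0n double_gt0.
pose x i : R := (m0 + i)%:R * al.
pose phi i := Num.truncn (q.*2%:R * fracpart (x i)).
have phiP i : (phi i)%:R <= q.*2%:R * fracpart (x i) < (phi i).+1%:R.
  apply: truncn_itv; rewrite mulr_ge0 //; by case/andP: (fracpart_itv (x i)).
have phi_lt i : (phi i < q.*2)%N.
  rewrite -(ltr_nat R); case/andP: (phiP i) => h _; apply: le_lt_trans h _.
  by rewrite gtr_pMr //; case/andP: (fracpart_itv (x i)).
have phi_inj' i i' : (i < i')%N -> (i' < q./2.+1)%N -> phi i <> phi i'.
  move=> ii iq e.
  have im : (0 < i' - i)%N by rewrite subn_gt0.
  have imq : ((i' - i).*2 <= q)%N by have := odd_double_half q; lia.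
  have := @rational_approx_separation a (Num.floor (x i') - Num.floor (x i))
    q _ al q0 im imq aq ha.
  have -> : (i' - i)%:R * al - (Num.floor (x i') - Num.floor (x i))%:~R =
     fracpart (x i') - fracpart (x i).
    by rewrite /fracpart intrB natrB ?(ltnW ii) // /x !natrD; ring.
  apply/negP; rewrite -ltNge -[X in _ < X]mul1r ltr_pdivlMr //.
  rewrite -[X in _ * X](gtr0_norm qq) -normrM.
  have := phiP i; have := phiP i'; rewrite e -natr1 => /andP[h1 h2] /andP[h3 h4].
  by rewrite ltr_norml mulrBl ![_ * q.*2%:R]mulrC; lra.
(* Cell s is at least s / 2q above one integer and (2q - 1 - s) / 2q below the next. The two end
   cells get the trivial bound 1; there one of the inverses is the default value 0. *)
pose b s : R := (s == 0%N)%:R + (s == q.*2.-1)%:R +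
  2 * (q%:R / N%:R) * (s%:R^-1 + (q.*2.-1 - s)%:R^-1).
have hb i : kap N (x i) <= b (phi i).
  have c0 : 0 <= 2 * (q%:R / N%:R) * ((phi i)%:R^-1 + (q.*2.-1 - phi i)%:R^-1) :> R.
    by rewrite !mulr_ge0 ?addr_ge0 ?invr_ge0.
  have [s0|s0] := eqVneq (phi i) 0%N.
    by apply: le_trans (kap_le1 _ _) _; rewrite /b s0 eqxx -s0 -addrA lerDl addr_ge0.
  have [s1|s1] := eqVneq (phi i) q.*2.-1.
    apply: le_trans (kap_le1 _ _) _; move: c0; rewrite /b.
    set c := 2 * (_ / _) * _ => c0; rewrite s1 eqxx [true%:R]mulr1n.
    by have := ler0n R (q.*2.-1 == 0%N); lra.
  rewrite /b (negbTE s0) (negbTE s1) !add0r; set s := phi i.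
  have sp : 0 < s%:R :> R by rewrite ltr0n lt0n.
  have tp : 0 < (q.*2.-1 - s)%:R :> R.
    by rewrite ltr0n subn_gt0 ltn_neqAle s1 -ltnS prednK ?double_gt0 ?phi_lt.
  have es : (q.*2.-1 - s)%:R = q.*2%:R - s.+1%:R :> R.
    by rewrite -natrB ?phi_lt // -subn1 -subnDA add1n.
  have key eta : 0 < eta -> eta <= s%:R / q.*2%:R -> eta <= (q.*2.-1 - s)%:R / q.*2%:R ->
      kap N (x i) <= (N%:R * eta)^-1.
    move=> e0 e1 e2; apply: kap_le => // m; have /andP[p1 p2] := phiP i.
    have f1 : s%:R / q.*2%:R <= fracpart (x i) by rewrite ler_pdivrMr // mulrC.
    have f2 : (q.*2.-1 - s)%:R / q.*2%:R <= 1 - fracpart (x i).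
      by rewrite ler_pdivrMr // es mulrBl mul1r (mulrC (fracpart _)) lerD2l lerN2 ltW.
    rewrite /fracpart in f1 f2.
    have [hm|hm] := lerP m (Num.floor (x i)).
      apply: le_trans (ler_norm _); have : m%:~R <= (Num.floor (x i))%:~R :> R by rewrite ler_int.
      lra.
    rewrite -normrN opprB; apply: le_trans (ler_norm _).
    have : (Num.floor (x i) + 1)%:~R <= m%:~R :> R by rewrite ler_int lezD1.
    rewrite intrD; lra.
  have fin u : 0 < u -> (N%:R * (u / q.*2%:R))^-1 = 2 * (q%:R / N%:R) * u^-1 :> R.
    by move=> u0; rewrite -muln2 natrM; field; rewrite !gt_eqF.
  have [h|h] := leP (s%:R : R) (q.*2.-1 - s)%:R.
    apply: le_trans (key (s%:R / q.*2%:R) _ _ _) _; rewrite ?divr_gt0 // ?ler_pM2r ?invr_gt0 //.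
    by rewrite fin // mulrDr lerDl !mulr_ge0 ?invr_ge0.
  apply: le_trans (key ((q.*2.-1 - s)%:R / q.*2%:R) _ _ _) _; rewrite ?divr_gt0 // ?ler_pM2r ?invr_gt0 // ?(ltW h) //.
  by rewrite fin // mulrDr lerDr !mulr_ge0 ?invr_ge0.
have b0 s : 0 <= b s by rewrite /b !addr_ge0 // !mulr_ge0 ?addr_ge0 ?invr_ge0.
apply: (@le_trans _ _ (\sum_(0 <= s < q.*2) b s)).
  rewrite !big_mkord; pose ph (i : 'I_(q./2.+1)) : 'I_(q.*2) := Ordinal (phi_lt i).
  have ph_inj : injective ph.
    move=> i i' /(congr1 val) /= e; apply: val_inj => /=.
    case: (ltngtP i i') => // h; first by case: (phi_inj' _ _ h (ltn_ord _)).
    by case: (phi_inj' _ _ h (ltn_ord _)).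
  apply: (@le_trans _ _ (\sum_(i < q./2.+1) b (ph i))); first by apply: ler_sum => i _; exact: hb.
  rewrite -(big_imset (fun s : 'I_(q.*2) => b s)) /=; last by move=> ? ? _ _ /ph_inj.
  by rewrite [leRHS](bigID (mem (ph @: 'I_(q./2.+1)))) /= lerDl sumr_ge0.
rewrite /b !big_split /= -mulr_sumr big_split /=.
have ind t : \sum_(0 <= s < q.*2) (s == t)%:R <= 1 :> R.
  have [tq|tq] := ltnP t q.*2; last first.
    rewrite big_nat_cond big1 // => s /andP[/andP[_ sq] _].
    by rewrite (_ : (s == t) = false) //; apply/negbTE; rewrite neq_ltn (leq_trans sq tq).
  by rewrite big_mkord (bigD1 (Ordinal tq)) //= eqxx big1 ?addr0 // => s; rewrite -val_eqE /= => /negbTE ->.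
have hh : \sum_(0 <= s < q.*2) s%:R^-1 <= 1 + ln q.*2%:R :> R.
  apply: le_trans (harmonic_le_ln _); last by rewrite double_gt0.
  by rewrite big_ltn ?double_gt0 // invr0 add0r big_nat_recr ?double_gt0 //= lerDl invr_ge0.
have -> : \sum_(0 <= s < q.*2) (q.*2.-1 - s)%:R^-1 = \sum_(0 <= s < q.*2) s%:R^-1 :> R.
  rewrite [RHS]big_nat_rev /=; apply: eq_big_nat => s /andP[_ sq]; congr (_%:R^-1); lia.
have c0 : 0 <= 2 * (q%:R / N%:R) :> R by rewrite mulr_ge0.
have := ler_wpM2l c0 (lerD hh hh); have := ind 0%N; have := ind q.*2.-1.
rewrite -mulr2n -[_ *+ 2]mulr_natl; lra.
Qed.

(** The range is cut into blocks of q./2.+1 > q/2 terms, at most 2 X / q + 1 of them. *)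
Lemma sum_kap_le (a : int) (q N X : nat) (al : R) : (0 < q)%N -> (0 < N)%N ->
  coprime `|a| q -> `|al - a%:~R / q%:R| <= (q%:R ^+ 2)^-1 ->
  \sum_(1 <= m < X.+1) kap N (m%:R * al) <=
    (2 * X%:R / q%:R + 1) * (2 + 4 * (q%:R / N%:R) * (1 + ln (q.*2%:R))).
Proof.
move=> q0 N0 aq ha; set U := 2 + _; have q1 : 0 < q%:R :> R by rewrite ltr0n.
have hB B : \sum_(0 <= m < B * q./2.+1) kap N (m%:R * al) <= B%:R * U.
  elim: B => [|B ih]; first by rewrite big_geq // mul0r.
  rewrite mulSnr (@big_cat_nat _ _ _ (B * q./2.+1)) ?leq_addr //= -natr1 mulrDl mul1r lerD //.
  rewrite -{1}[(B * _)%N]add0n big_addn addKn.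
  by under eq_bigr do rewrite addnC; exact: (sum_kap_block _ q0 N0 aq ha).
have U0 : 0 <= U.
  apply: le_trans (sum_kap_block 0 q0 N0 aq ha).
  by rewrite sumr_ge0 // => i _; exact: kap_ge0.
set B := (X %/ q./2.+1).+1.
apply: (@le_trans _ _ (B%:R * U)).
  apply: le_trans (hB B); rewrite (@big_cat_nat _ _ _ X.+1 0%N) //=; last exact: ltn_ceil.
  apply: (@le_trans _ _ (\sum_(0 <= m < X.+1) kap N (m%:R * al))).
    by rewrite [leRHS]big_ltn // lerDr kap_ge0.
  by rewrite lerDl sumr_ge0 // => i _; exact: kap_ge0.
apply: ler_wpM2r => //; rewrite /B -(natr1 (X %/ _)) lerD2r.
rewrite ler_pdivlMr // -!natrM; apply: (@le_trans _ _ ((X %/ q./2.+1) * (2 * q./2.+1))%N%:R).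
  by rewrite ler_nat leq_mul2l; apply/orP; right; have := odd_double_half q; lia.
by rewrite ler_nat mulnCA leq_mul2l leq_trunc_div orbT.
Qed.

End SeparatedSums.

(** * The divisor bound *)

Section DivisorBound.
Variable R : realType.

(** A divisor is determined by its p-adic valuation and its part prime to p. *)
Lemma size_divisors_part p n : (0 < n)%N ->
  (size (divisors n) <= (logn p n).+1 * size (divisors n`_p^'))%N.
Proof.
move=> n0; have := n0; have m0 := part_gt0 p^' n.
pose h d := (logn p d, (d`_p^')%N).
rewrite -(size_map h) -[X in (_ <= X * _)%N](size_iota 0) -(size_allpairs pair).
move=> _; apply: uniq_leq_size.
  rewrite map_inj_in_uniq ?divisors_uniq // => d d'.
  rewrite -!dvdn_divisors // => dn dn' [e1 e2].
  have d0 := dvdn_gt0 n0 dn; have d0' := dvdn_gt0 n0 dn'.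
  by rewrite -(partnC p d0) -(partnC p d0') !p_part e1 e2.
move=> x /mapP[d]; rewrite -dvdn_divisors // => dn ->.
apply/allpairsP; exists (h d); split; last by [].
  by rewrite mem_iota add0n ltnS dvdn_leq_log.
by rewrite -dvdn_divisors // partn_dvd.
Qed.

(** A prime power p^a contributes a + 1 divisors, to be compared with p^(a e). Primes p >= 2^(1/e)
    lose nothing, and each of the fewer than [B] smaller ones loses at most a factor [K]. *)
Lemma size_divisors_le (e : R) : 0 < e ->
  exists2 C : R, 0 <= C & forall n, (0 < n)%N -> (size (divisors n))%:R <= C * n%:R `^ e.
Proof.
move=> e0; have l2 : 0 < ln (2 : R) by rewrite ln_gt0 // ltr1n.
(* With E = e ln 2 one has p^(a e) >= exp(a E) >= 1 + a E, and (1 + 1/E) (1 + a E) >= a + 1. *)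
pose K : R := 1 + (e * ln 2)^-1; have i0 : 0 < (e * ln (2 : R))^-1 by rewrite invr_gt0 mulr_gt0.
have K1 : 1 <= K by rewrite lerDl ltW.
have hK p a : (2 <= p)%N -> a.+1%:R <= K * (p ^ a)%N%:R `^ e.
  move=> p2; apply: (@le_trans _ _ (K * (2 ^ a)%N%:R `^ e)); last first.
    rewrite ler_wpM2l ?(le_trans _ K1) //; apply: ge0_ler_powR; rewrite ?nnegrE ?(ltW e0) //.
    by case: (a) => [|b]; rewrite ler_nat ?expn0 ?leq_exp2r.
  have -> : (2 ^ a)%N%:R `^ e = expR (a%:R * (e * ln 2)) :> R.
    by rewrite natrX /powR gt_eqF ?exprn_gt0 // lnXn // -mulr_natr; congr expR; ring.
  apply: (@le_trans _ _ (K * (1 + a%:R * (e * ln 2)))); last first.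
    by rewrite ler_wpM2l ?(le_trans _ K1) // expR_ge1Dx.
  have E0 : 0 < e * ln (2 : R) by rewrite mulr_gt0.
  have -> : K * (1 + a%:R * (e * ln 2)) = 1 + a%:R * (e * ln 2) + (e * ln 2)^-1 + a%:R.
    by rewrite /K; move: E0; set E := e * ln 2 => E0; field; rewrite gt_eqF.
  have : 0 <= a%:R * (e * ln (2 : R)) by rewrite mulr_ge0 // ltW.
  by rewrite -natr1; lra.
(* Beyond this bound p^e >= 2, and 2^a >= a + 1. *)
pose B := (Num.truncn (2 `^ e^-1 : R)).+1.
have hB p a : (B <= p)%N -> a.+1%:R <= (p ^ a)%N%:R `^ e :> R.
  move=> Bp; have p2 : 2 `^ e^-1 <= p%:R :> R.
    by apply: ltW; apply: (lt_le_trans (truncnS_gt _)); rewrite ler_nat.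
  apply: (@le_trans _ _ (2 ^ a)%N%:R); first by rewrite ler_nat ltn_expl.
  rewrite !natrX -!powR_mulrn // powRAC; apply: ge0_ler_powR; rewrite ?nnegrE ?powR_ge0 //.
  have := @ge0_ler_powR _ e (ltW e0) _ _ (powR_ge0 _ _) (ler0n _ _) p2.
  by rewrite -powRrM mulVf ?gt_eqF // powRr1.
exists (K ^+ B); first by rewrite exprn_ge0 // (le_trans _ K1).
(* Induction on a strict upper bound [k] for the prime factors; the exponent [minn k B] stops
   growing at [B]. *)
suff H k n : (0 < n)%N -> (forall p, p \in primes n -> (p < k)%N) ->
    (size (divisors n))%:R <= K ^+ minn k B * n%:R `^ e.
  move=> n n0; apply: le_trans (H n.+1 n n0 _) _.
    by move=> p; rewrite mem_primes ltnS => /and3P[_ _ /dvdn_leq]; apply.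
  by rewrite ler_wpM2r ?powR_ge0 // ler_weXn2l // geq_minr.
elim: k n => [|k ih] n n0 hn.
  rewrite min0n expr0 mul1r; have [n1|n1] := leqP n 1.
    have -> : n = 1%N by apply/eqP; rewrite eqn_leq n1.
    by rewrite powR1.
  by have := hn (pdiv n); rewrite pi_pdiv n1 => /(_ isT).
have K0 : 0 <= K by rewrite (le_trans _ K1).
have [kn|kn] := boolP (k \in primes n); last first.
  apply: le_trans (ih n n0 _) _.
    move=> p pn; have := hn p pn; rewrite ltnS leq_eqVlt => /predU1P[pk|//].
    by rewrite -pk pn in kn.
  rewrite ler_wpM2r ?powR_ge0 // ler_weXn2l // leq_min geq_minr.
  by rewrite (leq_trans (geq_minl _ _)) // leqnSn.
have kp : prime k by move: kn; rewrite mem_primes => /andP[].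
have hm : (size (divisors (n`_k^')%N))%:R <= K ^+ minn k B * (n`_k^')%N%:R `^ e.
  apply: ih => // p; rewrite primes_part mem_filter => /andP[pk /hn].
  by rewrite ltnS leq_eqVlt => /predU1P[e1|//]; rewrite e1 inE /= inE eqxx in pk.
apply: (@le_trans _ _ ((logn k n).+1%:R * (K ^+ minn k B * (n`_k^')%N%:R `^ e))).
  apply: (@le_trans _ _ ((logn k n).+1 * size (divisors (n`_k^')%N))%N%:R).
    by rewrite ler_nat size_divisors_part.
  by rewrite natrM ler_wpM2l.
rewrite -{3}(partnC k n0) p_part natrM powRM // mulrCA mulrA [leRHS]mulrA.
rewrite ler_wpM2r ?powR_ge0 //.
have [kB|kB] := ltnP k B.
  rewrite (minn_idPl kB) exprSr -mulrA.
  by rewrite ler_wpM2l ?exprn_ge0 // hK // prime_gt1.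
by rewrite (minn_idPr (leqW kB)) ler_wpM2l ?exprn_ge0 // hB.
Qed.

End DivisorBound.

(** * Collapsing the Weyl mean to a single summation variable *)

Section WeylMean.
Variable R : realType.

Lemma sum_multiples_le (F : nat -> R) (h M X : nat) : (0 < h)%N -> (h * M <= X)%N ->
  (forall n, 0 <= F n) ->
  \sum_(1 <= m < M.+1) F (h * m)%N <= \sum_(1 <= n < X.+1) (h %| n)%:R * F n.
Proof.
move=> h0 hMX F0; elim: M X hMX => [|M ih] X hMX.
  by rewrite big_geq // sumr_ge0 // => n _; rewrite mulr_ge0.
rewrite big_nat_recr //= [leRHS](@big_cat_nat _ _ _ (h * M).+1) //=; last first.
  by rewrite ltnS (leq_trans _ hMX) // leq_mul2l leqnSn orbT.
apply: lerD; first exact: ih.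
rewrite (@big_cat_nat _ _ _ (h * M.+1)%N) //=; last 2 first.
- by rewrite mulnS -addn1 addnC leq_add2r.
- exact: leqW.
rewrite ler_wpDl //; first by rewrite sumr_ge0 // => n _; rewrite mulr_ge0.
rewrite big_ltn // dvdn_mulr // mul1r lerDl.
by rewrite sumr_ge0 // => n _; rewrite mulr_ge0.
Qed.

Lemma sum_dvdn_le_divisors (H n : nat) : (0 < n)%N ->
  \sum_(1 <= h < H) (h %| n)%:R <= (size (divisors n))%:R :> R.
Proof.
move=> n0; rewrite -natr_sum ler_nat.
have -> : (\sum_(1 <= h < H) (h %| n) = count (fun h => h %| n)%N (index_iota 1 H))%N.
  by rewrite -sum1_count [RHS]big_mkcond /=; apply: eq_bigr => i _; case: (i %| n)%N.
rewrite -size_filter; apply: uniq_leq_size; first by rewrite filter_uniq // iota_uniq.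
by move=> h; rewrite mem_filter -dvdn_divisors // => /andP[].
Qed.

(** Each n is a product h m in at most as many ways as it has divisors. *)
Lemma sum_products_le (F : nat -> R) (H M : nat) : (forall n, 0 <= F n) ->
  \sum_(1 <= h < H) \sum_(1 <= m < M.+1) F (h * m)%N <=
    \sum_(1 <= n < (H * M).+1) (size (divisors n))%:R * F n.
Proof.
move=> F0; apply: (@le_trans _ _
   (\sum_(1 <= h < H) \sum_(1 <= n < (H * M).+1) (h %| n)%:R * F n)).
  rewrite !big_nat; apply: ler_sum => h /andP[h0 hH].
  by apply: sum_multiples_le => //; rewrite leq_mul2r ltnW // orbT.
rewrite exchange_big /= !big_nat; apply: ler_sum => n /andP[n0 _].
by rewrite -mulr_suml ler_wpM2r // sum_dvdn_le_divisors.
Qed.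

(** The products h_1 ... h_j become one variable m <= N^j. At each step half of [e] pays for the
    induction hypothesis and half for the divisor bound, used with exponent e / 2 / (j + 1) since n
    goes up to N^(j+1). *)
Lemma weyl_mean_le (j : nat) (e : R) : 0 < e -> exists2 D : R, 0 <= D &
  forall N (a : R), (0 < N)%N -> weyl_mean j N a <=
    D * N%:R `^ e / N%:R ^+ j * \sum_(1 <= m < (N ^ j).+1) kap N (m%:R * a).
Proof.
elim: j e => [|j ih] e e0.
  exists 1 => // N a N0; rewrite expn0 big_nat1 /= mul1r expr0 invr1 mulr1 mul1r.
  by rewrite ler_peMl ?kap_ge0 // -[leLHS](powRr0 N%:R) ler_powR ?(ltW e0) // ler1n.
have e2 : 0 < e / 2 by rewrite divr_gt0.
have [D D0 hD] := ih _ e2.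
have [C C0 hC] := @size_divisors_le R (e / 2 / j.+1%:R) (divr_gt0 e2 (ltr0Sn _ _)).
exists (D * C); first exact: mulr_ge0.
move=> N a N0 /=; have N1 : 0 < N%:R :> R by rewrite ltr0n.
have hdiv n : (0 < n)%N -> (n <= N ^ j.+1)%N -> (size (divisors n))%:R <= C * N%:R `^ (e / 2).
  move=> n0 nN; apply: le_trans (hC n n0) _; rewrite ler_wpM2l //.
  have -> : N%:R `^ (e / 2) = (N ^ j.+1)%N%:R `^ (e / 2 / j.+1%:R) :> R.
    by rewrite natrX -powR_mulrn // -powRrM [j.+1%:R * _]mulrC divfK.
  by apply: ge0_ler_powR; rewrite ?nnegrE ?ler_nat // divr_ge0 ?(ltW e2).
have bnd : \sum_(1 <= h < N) weyl_mean j N (h%:R * a) <= D * N%:R `^ (e / 2) / N%:R ^+ j *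
    (C * N%:R `^ (e / 2) * \sum_(1 <= n < (N ^ j.+1).+1) kap N (n%:R * a)).
  apply: (@le_trans _ _ (\sum_(1 <= h < N) D * N%:R `^ (e / 2) / N%:R ^+ j *
      \sum_(1 <= m < (N ^ j).+1) kap N ((h * m)%N%:R * a))).
    apply: ler_sum => h _; apply: le_trans (hD N _ N0) _.
    rewrite le_eqVlt; apply/orP; left; apply/eqP; congr (_ * _); apply: eq_bigr => m _.
    by rewrite natrM mulrCA mulrA.
  rewrite -mulr_sumr ler_wpM2l ?divr_ge0 ?mulr_ge0 ?powR_ge0 ?exprn_ge0 //.
  have F0 n : 0 <= kap N (n%:R * a) by exact: kap_ge0.
  apply: le_trans (sum_products_le N (N ^ j) F0) _.
  rewrite -expnS mulr_sumr !big_nat; apply: ler_sum => n /andP[n0 nN].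
  by rewrite ler_wpM2r ?kap_ge0 // hdiv.
apply: le_trans (ler_wpM2l _ bnd) _; first by rewrite invr_ge0.
rewrite le_eqVlt; apply/orP; left; apply/eqP.
have -> : N%:R `^ e = N%:R `^ (e / 2) * N%:R `^ (e / 2) :> R.
  by rewrite -powRD -?splitr // gt_eqF // implybT.
by rewrite exprS; field; rewrite ?expf_neq0 ?gt_eqF.
Qed.

End WeylMean.

(** * Dirichlet approximation, and sums near a rational *)

Section MajorArcs.
Variable R : realType.

(** Pigeonhole: two of the H + 1 fractional parts of i [al], 0 <= i <= H, share one of H cells. *)
Lemma Dirichlet_approximation (al : R) (H : nat) : (0 < H)%N -> exists (a : int) (q : nat),
  [/\ (0 < q <= H)%N, coprime `|a| q & `|al - a%:~R / q%:R| <= (q%:R * H%:R)^-1].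
Proof.
move=> H0; have H1 : 0 < H%:R :> R by rewrite ltr0n.
pose x i : R := i%:R * al; pose phi i := Num.truncn (H%:R * fracpart (x i)).
have phiP i : (phi i)%:R <= H%:R * fracpart (x i) < (phi i).+1%:R.
  by apply: truncn_itv; rewrite mulr_ge0 //; case/andP: (fracpart_itv (x i)).
have phi_lt i : (phi i < H)%N.
  rewrite -(ltr_nat R); case/andP: (phiP i) => h _; apply: le_lt_trans h _.
  by rewrite gtr_pMr //; case/andP: (fracpart_itv (x i)).
have [i [i' [ii iH e]]] : exists i i', [/\ (i < i')%N, (i' < H.+1)%N & phi i = phi i'].
  pose ph (i : 'I_H.+1) : 'I_H := Ordinal (phi_lt i).
  have /injectivePn[i [i' ne e]] : ~~ injectiveb ph.
    by apply/negP => /injectiveP /leq_card; rewrite !card_ord ltnn.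
  have {}e : phi i = phi i' by case: e.
  have [h|h|h] := ltngtP i i'; last by rewrite (val_inj h) eqxx in ne.
    by exists i, i'.
  by exists i', i.
pose m := (i' - i)%N; pose b := Num.floor (x i') - Num.floor (x i).
have m0 : (0 < m)%N by rewrite subn_gt0.
have m1 : 0 < m%:R :> R by rewrite ltr0n.
have hb : `|m%:R * al - b%:~R| <= H%:R^-1.
  have -> : m%:R * al - b%:~R = fracpart (x i') - fracpart (x i).
    by rewrite /b /fracpart intrB /m natrB ?(ltnW ii) // /x; ring.
  rewrite -[leRHS]mul1r ler_pdivlMr // -[X in _ * X](gtr0_norm H1) -normrM.
  have := phiP i; have := phiP i'; rewrite e -natr1 => /andP[h1 h2] /andP[h3 h4].
  by rewrite ler_norml mulrBl ![_ * H%:R]mulrC; lra.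
(* Reducing b/m to lowest terms keeps the fraction and shrinks the denominator, which only weakens
   the required bound. *)
pose g := gcdn `|b| m; have g0 : (0 < g)%N by rewrite gcdn_gt0 m0 orbT.
have gm : (g %| m)%N := dvdn_gcdr _ _.
have /dvdnP[b' eb] : (g %| `|b|)%N := dvdn_gcdl _ _.
have em : m = ((m %/ g) * g)%N by rewrite divnK.
have q0 : (0 < m %/ g)%N by rewrite divn_gt0 // dvdn_leq.
have q1 : 0 < (m %/ g)%:R :> R by rewrite ltr0n.
have g1 : 0 < g%:R :> R by rewrite ltr0n.
exists (Num.sg b * b'%:Z), (m %/ g)%N; split.
- rewrite q0 (leq_trans (leq_div _ _)) // (leq_trans (leq_subr _ _)) //.
- have co : coprime b' (m %/ g).
    by rewrite /coprime -(eqn_pmul2r g0) mul1n muln_gcdl -eb -em.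
  have [b0|b0] := eqVneq b 0.
    have b'0 : b' = 0%N.
      by apply/eqP; move/eqP: eb; rewrite b0 absz0 eq_sym muln_eq0 (gtn_eqF g0) orbF.
    by rewrite b0 sgr0 mul0r absz0 -b'0.
  case: (ltrgtP b 0) b0 => // [bn|bp] _; last by rewrite gtr0_sg // mul1r.
  by rewrite ltr0_sg // mulN1r abszN.
have -> : (Num.sg b * b'%:Z)%:~R / (m %/ g)%:R = b%:~R / m%:R :> R.
  rewrite {2}[b]numEsg -abszE eb {2}em PoszM mulrA !intrM !natrM -!pmulrn.
  by field; rewrite !gt_eqF.
have -> : al - b%:~R / m%:R = (m%:R * al - b%:~R) / m%:R by field; rewrite gt_eqF.
rewrite normrM normfV (gtr0_norm m1) invfM mulrC ler_pM ?invr_ge0 //.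
by rewrite lef_pV2 ?posrE // ler_nat leq_div.
Qed.

Lemma horner_poly_le (p : {poly R}) m (x : R) : (size p <= m.+1)%N -> 1 <= x ->
  `|p.[x]| <= (\sum_(i < m.+1) `|p`_i|) * x ^+ m.
Proof.
move=> sp x1; rewrite (horner_coef_wide _ sp) mulr_suml.
apply: le_trans (ler_norm_sum _ _ _) _; apply: ler_sum => i _.
rewrite normrM ler_wpM2l // ger0_norm ?exprn_ge0 ?(le_trans _ x1) //.
by rewrite ler_weXn2l // -ltnS.
Qed.

(** This makes the phase a omega(n) / q periodic modulo 1 with period q. *)
Lemma horner_int_congr (p : {poly int}) (x y : int) : exists k, p.[x] - p.[y] = k * (x - y).
Proof.
have /factor_theorem[r hr] : root (p - p.[y]%:P) y.
  by rewrite /root hornerD hornerN hornerC subrr.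
exists r.[x]; have := congr1 (fun s => s.[x]) hr.
by rewrite hornerM hornerXsubC hornerD hornerN hornerC.
Qed.

(** The distance from resonance enters through [eta] alone; the arithmetic of [c] that provides it
    is left to [resonance_free_le]. *)
Lemma major_arc_le (omega : {poly int}) (j : nat) : (size omega <= j.+3)%N ->
  exists2 C : R, 0 <= C & forall (N q : nat) (a : int) (be th eta : R),
  (0 < N)%N -> (0 < q)%N -> 0 < eta -> eta <= normc (1 - expi (2 * pi * (q%:R * th))) ->
  expsum (fun i => 2 * pi * ((a%:~R / q%:R + be) * (omega.[(N + i)%N%:Z])%:~R
     + (N + i)%N%:R * th)) N <= 2 * q%:R / eta * (1 + C * `|be| * N%:R ^+ j.+2).
Proof.
move=> sw; pose p : {poly R} := map_poly intr omega.
have sp : (size p <= j.+3)%N by apply: leq_trans (size_poly _ _) sw.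
have pE n : p.[n%:R] = (omega.[n%:Z])%:~R by rewrite /p -[n%:R]/(n%:Z%:~R) horner_map.
pose r := poly_diff p 1; have sr : (size r <= j.+2)%N by exact: size_poly_diff.
pose K : R := \sum_(i < j.+2) `|r`_i|; have K0 : 0 <= K by rewrite sumr_ge0.
have pi0 := @pi_gt0 R.
exists (2 * (2 * pi * K * 3 ^+ j.+1)); first by rewrite !mulr_ge0 ?exprn_ge0 // ltW.
move=> N q a be th eta N0 q0 e0 he; have q1 : 0 < q%:R :> R by rewrite ltr0n.
have N1 : 1 <= N%:R :> R by rewrite ler1n.
pose g i := expi (2 * pi * (a%:~R / q%:R * (omega.[(N + i)%N%:Z])%:~R + (N + i)%N%:R * th)).
pose w i := expi (2 * pi * (be * (omega.[(N + i)%N%:Z])%:~R)).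
rewrite /expsum (_ : \sum_(0 <= n < N) _ = \sum_(0 <= n < N) g n * w n); last first.
  by apply: eq_bigr => i _; rewrite -expiD; congr expi; ring.
apply: Abel_sum_le => [|n|t|]; first by rewrite divr_ge0 ?mulr_ge0 // ltW.
- by rewrite normc_expi.
- rewrite ler_pdivlMr //; apply: le_trans (ler_wpM2l (normc_ge0 _) he) _.
  apply: quasi_periodic_sum => [n|n]; first by rewrite normc_expi.
  (* Over a shift by q the rational phase changes by the integer a k, so only exp(2 pi i q th)
     remains. *)
  have [k hk] := horner_int_congr omega (N + (n + q))%N%:Z (N + n)%N%:Z.
  have {}hk : omega.[(N + (n + q))%N%:Z] = omega.[(N + n)%N%:Z] + k * q%:Z.
    by apply/eqP; rewrite addrC -subr_eq hk addnA PoszD addrAC subrr add0r.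
  rewrite /g -expiD hk intrD intrM -!pmulrn -[LHS]mulr1 -(expi_int R (- (a * k))) -expiD; congr expi.
  rewrite addnA (natrD _ (N + n)) intrN intrM; field; rewrite gt_eqF //.
(* One step changes the phase of [w] by 2 pi be r(N + i) with [r] of degree at most j + 1; the N
   steps together cost |be| N^(j+2). *)
have step i : (i < N)%N -> normc (w i.+1 - w i) <= 2 * (2 * pi * K * 3 ^+ j.+1) * `|be| * N%:R ^+ j.+1.
  move=> iN; apply: le_trans (normc_expiB_le _ _) _.
  rewrite -!mulrBr -!pE addnS -[in X in p.[X] - _]natr1 -horner_poly_diff -/r.
  have h1 : 1 <= (N + i)%N%:R :> R by rewrite ler1n addn_gt0 N0.
  have hr : `|r.[(N + i)%N%:R]| <= K * 3 ^+ j.+1 * N%:R ^+ j.+1.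
    apply: le_trans (horner_poly_le sr h1) _; rewrite -/K -mulrA ler_wpM2l //.
    by rewrite -exprMn lerXn2r ?nnegrE ?mulr_ge0 // -natrM ler_nat; lia.
  rewrite !normrM (gtr0_norm pi0) (ger0_norm (ler0n _ 2)).
  have -> : 2 * (2 * pi * K * 3 ^+ j.+1) * `|be| * N%:R ^+ j.+1 =
    2 * (2 * pi * (`|be| * (K * 3 ^+ j.+1 * N%:R ^+ j.+1))) by ring.
  by rewrite !ler_wpM2l // mulr_ge0 // ltW.
apply: (@le_trans _ _ (\sum_(0 <= n < N) 2 * (2 * pi * K * 3 ^+ j.+1) * `|be| * N%:R ^+ j.+1)).
  by rewrite !big_nat; apply: ler_sum => i /andP[_]; exact: step.
by rewrite sumr_const_nat subn0 -[leLHS]mulr_natr -mulrA -exprSr.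
Qed.

End MajorArcs.

(** * A Diophantine property of almost every [c] *)

Section Diophantine.
Variable R : realType.
Local Open Scope classical_set_scope.
Let mu := @lebesgue_measure R.

Lemma sum_powR_le (e : R) n : 0 < e ->
  \sum_(0 <= q < n) (q.+1%:R `^ (1 + e))^-1 <= 1 + e^-1.
Proof.
move=> e0; have ei : 0 < e^-1 by rewrite invr_gt0.
case: n => [|n]; first by rewrite big_geq // addr_ge0 // ltW.
(* Strengthened for the induction: the right side is 1 plus the integral of t^(-1-e) from 1 to n +
   1. *)
suff : \sum_(0 <= q < n.+1) (q.+1%:R `^ (1 + e))^-1 <= 1 + e^-1 * (1 - (n.+1%:R `^ e)^-1).
  move/le_trans; apply; rewrite lerD2l ler_piMr ?(ltW ei) // gerBl invr_ge0 powR_ge0 //.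
elim: n => [|n ih]; first by rewrite big_nat1 !powR1 invr1 subrr mulr0 addr0.
rewrite big_nat_recr //=; apply: le_trans (lerD ih (lexx _)) _.
rewrite powRD ?powRr1 //; last by rewrite pnatr_eq0 implybT.
have A0 : 0 < n.+1%:R `^ e :> R by rewrite powR_gt0.
have B0 : 0 < n.+2%:R `^ e :> R by rewrite powR_gt0.
have s0 : 0 < n.+2%:R :> R by rewrite ltr0n.
have key : 1 + e / n.+2%:R <= n.+2%:R `^ e / n.+1%:R `^ e.
  rewrite /powR !pnatr_eq0 /= -expRB -mulrBr; apply: le_trans (expR_ge1Dx _).
  by rewrite lerD2l ler_pM2l // invn_le_lnB.
move: key; set A := n.+1%:R `^ e in A0 *; set B := n.+2%:R `^ e in B0 * => key.
have : e / n.+2%:R / B <= A^-1 - B^-1.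
  have -> : A^-1 - B^-1 = (B / A - 1) / B by field; rewrite !gt_eqF.
  by rewrite ler_pM2r ?invr_gt0 // lerBrDl.
rewrite -(ler_pM2l ei) (_ : e^-1 * (e / n.+2%:R / B) = (n.+2%:R * B)^-1); last first.
  by field; rewrite !gt_eqF.
by rewrite -addrA lerD2l -lerBrDl -mulrBr (_ : 1 - B^-1 - (1 - A^-1) = A^-1 - B^-1); last ring.
Qed.

Lemma negligible_from_covers (B : set R) (U : nat -> set R) (K : R) :
  (forall n, measurable (U n)) -> (forall n, (mu (U n) <= (K / n.+1%:R)%:E)%E) ->
  (forall n, B `<=` U n) -> mu.-negligible B.
Proof.
move=> mU hU BU; exists (\bigcap_n U n); split.
- exact: bigcapT_measurable.
- apply/eqP; rewrite eq_le measure_ge0 andbT; apply/lee_addgt0Pr => e e0; rewrite add0e.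
  pose n := Num.truncn (K / e).
  apply: (@le_trans _ _ (mu (U n))).
    apply: le_measure; rewrite ?inE; [exact: bigcapT_measurable|exact: mU|].
    by move=> x; exact.
  apply: le_trans (hU n) _; rewrite lee_fin ler_pdivrMr // mulrC -ler_pdivrMr // ltW //.
  exact: truncnS_gt.
- by move=> x Bx n _; exact: BU.
Qed.

(** For each q, O(q) balls of radius O(del q^(-2-e)) around the points b / (q lam) suffice, and the
    sum over q converges. [K] does not depend on [del], so the measure tends to 0 with [del]. *)
Lemma measure_near_rationals (lam e M : R) : 0 < lam -> 0 < e -> 0 < M ->
  exists2 K : R, 0 <= K & forall del : R, 0 < del -> del <= 1 ->
  exists U : set R, [/\ measurable U, (mu U <= (K * del)%:E)%E &
    forall (c : R) (q : nat) (b : int), `|c| <= M -> (0 < q)%N ->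
      `|q%:R * (lam * c) - b%:~R| < del / q%:R `^ (1 + e) -> U c].
Proof.
move=> l0 e0 M0.
(* There are at most 2 (q lam M + 1) + 1 <= (2 lam M + 3) q numerators for each q; the factor 2 /
   lam comes from the length of a ball. *)
pose K1 := (2 * lam * M + 3) * (2 / lam).
have K10 : 0 <= K1 by rewrite mulr_ge0 ?divr_ge0 ?addr_ge0 ?mulr_ge0 ?ltW.
exists (K1 * (1 + e^-1)); first by rewrite mulr_ge0 // addr_ge0 // invr_ge0 ltW.
move=> del d0 d1.
pose bd (q : nat) := Num.truncn (q.+1%:R * lam * M + 1).
pose rad (q : nat) := del / q.+1%:R `^ (1 + e) / (q.+1%:R * lam).
pose V q i := ball ((i%:R - (bd q)%:R) / (q.+1%:R * lam)) (rad q).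
pose W q := \big[setU/set0]_(i < (bd q).*2.+1) V q i.
have mV q i : measurable (V q i) by rewrite /V ball_itv; exact: measurable_itv.
have mW q : measurable (W q) by apply: bigsetU_measurable => i _.
have q0 q : 0 < q.+1%:R * lam by rewrite mulr_gt0.
have rad0 q : 0 <= rad q by rewrite !divr_ge0 ?powR_ge0 // ltW.
have hbd q : 0 <= q.+1%:R * lam * M + 1 by rewrite addr_ge0 // mulr_ge0 // ltW.
exists (\bigcup_q W q); split; first exact: bigcup_measurable.
- have hU : (mu (\bigcup_q W q) <= \sum_(q <oo) mu (W q))%E.
    apply: generalized_Boole_inequality => [i|]; first exact: mW.
    by apply: bigcup_measurable => i _; exact: mW.
  apply: le_trans hU _.
  have WK q : (mu (W q) <= (K1 * del * (q.+1%:R `^ (1 + e))^-1)%:E)%E.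
    have hV : (mu (W q) <= \sum_(i < (bd q).*2.+1) mu (V q i))%E.
      by apply: Boole_inequality => i _; exact: mV.
    apply: le_trans hV _.
    rewrite (eq_bigr (fun _ => (rad q *+ 2)%:E)); last by move=> i _; exact: lebesgue_measure_ball.
    rewrite sumEFin lee_fin sumr_const card_ord.
    have -> : K1 * del * (q.+1%:R `^ (1 + e))^-1 = (2 * lam * M + 3) * q.+1%:R * (rad q * 2).
      by rewrite /K1 /rad; field; rewrite !gt_eqF ?powR_gt0.
    rewrite -[leLHS]mulr_natl -(mulr_natr (rad q) 2) ler_wpM2r ?(mulr_ge0 (rad0 q)) //.
    have /andP[h _] := truncn_itv (hbd q); rewrite -/(bd q) in h.
    have h1 : 1 <= q.+1%:R :> R by rewrite ler1n.
    by rewrite -natr1 -muln2 natrM; nra.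
  apply: lime_le; first by apply: is_cvg_nneseries => n _ _; exact: measure_ge0.
  apply: nearW => n; apply: (@le_trans _ _
      (\sum_(0 <= q < n) (K1 * del * (q.+1%:R `^ (1 + e))^-1)%:E)%E).
    by apply: lee_sum => i _.
  rewrite sumEFin lee_fin -mulr_sumr mulrAC ler_wpM2r ?(ltW d0) // ler_wpM2l //.
  exact: sum_powR_le.
move=> c [//|q] b cM _ hc; exists q => //; rewrite /W -bigcup_mkord.
(* Here [del <= 1] is used: it confines the numerator [b] to the range covered by [W]. *)
have r1 : del / q.+1%:R `^ (1 + e) <= 1.
  rewrite ler_pdivrMr ?powR_gt0 // mul1r (le_trans d1) // -[leLHS](powRr0 q.+1%:R).
  by rewrite ler_powR ?ler1n // addr_ge0 // ltW.
have bb : `|b%:~R| < q.+1%:R * lam * M + 1.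
  have : `|q.+1%:R * (lam * c)| <= q.+1%:R * lam * M.
    by rewrite mulrA normrM (gtr0_norm (q0 q)) ler_wpM2l // ltW.
  have := ler_normB (q.+1%:R * (lam * c)) (q.+1%:R * (lam * c) - b%:~R).
  rewrite opprB addrC subrK; lra.
have bq : (`|b| <= bd q)%N.
  by rewrite truncn_ge_nat // natr_absz intr_norm ltW.
exists (absz (b + (bd q)%:Z)) => /=; first by lia.
have ei : (absz (b + (bd q)%:Z))%:R = b%:~R + (bd q)%:R :> R.
  by rewrite natr_absz ger0_norm ?intrD -?pmulrn //; lia.
rewrite /V ei addrK /ball /= -normrN opprB /rad ltr_pdivlMr //.
rewrite -[X in _ * X](gtr0_norm (q0 q)) -normrM mulrBl divfK ?gt_eqF //.
by rewrite [c * _]mulrC -mulrA.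
Qed.

(** To have one null set for all [e], the exceptional set is written as a countable union over e =
    1/(k+1) and |c| <= m + 1; the condition weakens as [e] grows. *)
Lemma ae_Diophantine (lam : R) : 0 < lam ->
  {ae mu, forall c : R, forall e : R, 0 < e -> exists2 del : R, 0 < del &
    forall (q : nat) (b : int), (0 < q)%N ->
      del / q%:R `^ (1 + e) <= `|q%:R * (lam * c) - b%:~R|}.
Proof.
move=> l0; pose ek (k : nat) : R := k.+1%:R^-1; have ek0 k : 0 < ek k by rewrite invr_gt0.
pose Bad k m := [set c : R | `|c| <= m.+1%:R /\ forall del : R, 0 < del ->
  exists (q : nat) (b : int), (0 < q)%N /\
    `|q%:R * (lam * c) - b%:~R| < del / q%:R `^ (1 + ek k)].
have hBad k m : mu.-negligible (Bad k m).
  have [K K0 hK] := measure_near_rationals l0 (ek0 k) (ltr0Sn R m).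
  have hd n : n.+1%:R^-1 <= 1 :> R by rewrite invf_le1 // ler1n.
  have [U hU] := choice (fun n => hK n.+1%:R^-1 (ek0 n) (hd n)).
  apply: (@negligible_from_covers _ U K) => n; have [? ? h] := hU n => // c [cM hc].
  by have [q [b [q0 hq]]] := hc _ (ek0 n); exact: h hq.
have : mu.-negligible (\bigcup_k \bigcup_m Bad k m).
  by apply: negligible_bigcup => k; apply: negligible_bigcup => m; exact: hBad.
apply: negligibleS => c hc; apply: contrapT => nB; apply: hc => e e0.
pose k := Num.truncn e^-1; pose m := Num.truncn `|c|.
have ke : ek k <= e.
  by rewrite /ek invf_ple ?posrE // ltW // truncnS_gt.
have cm : `|c| <= m.+1%:R by rewrite ltW // truncnS_gt.
apply: contrapT => nd; apply: nB; exists k => //; exists m => //; split=> // del d0.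
apply: contrapT => nq; apply: nd; exists del => // q b q0.
apply: (@le_trans _ _ (del / q%:R `^ (1 + ek k))).
  rewrite ler_pM2l // lef_pV2 ?posrE ?powR_gt0 ?ltr0n //.
  by rewrite ler_powR ?ler1n // lerD2l.
by rewrite leNgt; apply/negP => h; apply: nq; exists q, b.
Qed.

End Diophantine.

(** * Large denominators *)

Section MinorArcs.
Variable R : realType.

Lemma powR_natD (N : nat) (x y : R) : (0 < N)%N ->
  N%:R `^ (x + y) = N%:R `^ x * N%:R `^ y :> R.
Proof. by move=> N0; rewrite powRD // pnatr_eq0 gtn_eqF ?implybT. Qed.

Lemma kapN (N : nat) (t : R) : kap N (- t) = kap N t.
Proof. by rewrite /kap mulrN expiN_neg. Qed.

(** Passing from multiples of [A] to all integers allows a rational approximation to [al] itself to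
    be used, rather than one to [A * al]. *)
Lemma sum_kap_scaled_le (N A X : nat) (al : R) : (0 < A)%N ->
  \sum_(1 <= m < X.+1) kap N ((A * m)%N%:R * al) <=
    \sum_(1 <= n < (A * X).+1) kap N (n%:R * al).
Proof.
move=> A0; have F0 n : 0 <= kap N (n%:R * al) by exact: kap_ge0.
apply: le_trans (sum_multiples_le A0 (leqnn _) F0) _.
by apply: ler_sum => n _; case: (A %| n)%N; rewrite ?mul1r ?mul0r.
Qed.

Lemma ln_nat_le_powR (e : R) (N : nat) : 0 < e -> (0 < N)%N -> ln N%:R <= e^-1 * N%:R `^ e.
Proof.
move=> e0 N0; have N1 : N%:R != 0 :> R by rewrite pnatr_eq0 gtn_eqF.
rewrite ler_pdivlMl // /powR (negbTE N1).
by apply: le_trans (expR_ge1Dx _); rewrite lerDr.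
Qed.

(** [al] and [th] stand for y / (2 pi) and x / (2 pi), and i counts from N. *)
Definition shifted_phase (omega : {poly int}) (al th : R) (N i : nat) : R :=
  2 * pi * (al * (omega.[(N + i)%N%:Z])%:~R + (N + i)%N%:R * th).

(** With J = d - 1, the terms 1/q, 1/N, N^(-J) and q / N^d are all O(N^(-Q)), and the root of order
    2^J turns N^(-Q) into N^(-s). The divisor bound and the logarithm each lose N^e', whence e' = e
    2^J / 2. *)
Lemma minor_arc_le (omega : {poly int}) (j : nat) (Q s e : R) :
  size omega = j.+3 -> 0 <= Q -> Q <= 1 -> Q = 2 ^+ j.+1 * s -> 0 < e ->
  exists2 C : R, 0 <= C & forall (N q : nat) (a : int) (al th : R), (0 < N)%N ->
  (0 < q)%N -> coprime `|a| q -> `|al - a%:~R / q%:R| <= (q%:R ^+ 2)^-1 ->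
  N%:R `^ Q <= q%:R -> q%:R <= 2 * N%:R `^ (j.+2%:R - Q) ->
  expsum (shifted_phase omega al th N) N <= C * N%:R `^ (1 - s + e).
Proof.
move=> sw Q0 Q1 Qs e0; pose J := j.+1; pose e' := e * 2 ^+ J / 2.
have e'0 : 0 < e' by rewrite divr_gt0 // mulr_gt0 // exprn_gt0.
have [C1 C10 hC1] := @Weyl_differencing R J.
have [D D0 hD] := @weyl_mean_le R J _ e'0.
pose w := omega`_j.+2; have w0 : (0 < `|w|)%N.
  by rewrite absz_gt0; have := lead_coef_eq0 omega; rewrite /lead_coef sw /= -/w => ->; rewrite -size_poly_eq0 sw.
pose A := (j.+2`! * `|w|)%N; have A0 : (0 < A)%N by rewrite muln_gt0 fact_gt0.
have A1 : 0 <= A%:R :> R by [].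
(* Chosen so that 1 + ln (2q) <= K N^e', from 2q <= 4 N^d. *)
pose K := 1 + ln 4 + j.+2%:R / e'.
have ln4 : 0 <= ln 4 :> R by rewrite ln_ge0 // ler1n.
have K0 : 0 <= K.
  by apply: addr_ge0; [exact: addr_ge0|apply: divr_ge0 => //; exact: ltW].
pose C4 := C1 * (1 + D * ((12 * A%:R + 10) * K)).
have C40 : 0 <= C4.
  by rewrite mulr_ge0 // addr_ge0 // mulr_ge0 // mulr_ge0 // addr_ge0 // mulr_ge0.
exists (1 + C4); first by rewrite addr_ge0.
move=> N q a al th N0 q0 aq ha Yq qY.
have N1 : 0 < N%:R :> R by rewrite ltr0n.
have Nge1 : 1 <= N%:R :> R by rewrite ler1n.
have q1 : 0 < q%:R :> R by rewrite ltr0n.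
pose p := al *: (map_poly intr omega \Po ('X + (N%:R)%:P)) + th *: ('X + (N%:R)%:P).
have pE i : p.[i%:R] = al * (omega.[(N + i)%N%:Z])%:~R + (N + i)%N%:R * th.
  rewrite /p hornerD !hornerZ horner_comp !hornerE -natrD (addnC i) -[(N + i)%N%:R]/((N + i)%N%:Z%:~R).
  by rewrite horner_map mulrC [th * _]mulrC.
have sp : (size p <= j.+3)%N.
  apply: leq_trans (size_polyD _ _) _; rewrite geq_max.
  rewrite !(leq_trans (size_scale_leq _ _)) //; first by rewrite size_XaddC.
  by rewrite size_comp_poly2 ?size_XaddC // -sw size_poly.
(* The shift by N leaves the leading coefficient alone and [th] enters only in degree at most 1 < d,
   so the bound is uniform in [th]. *)
have pj : p`_j.+2 = al * w%:~R.
  rewrite coefD !coefZ coef_comp_XaddC coefD coefX coefC /= addr0 mulr0 addr0; congr (_ * _).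
  have -> : (map_poly intr omega)^`N(j.+2) = (w%:~R : R)%:P.
    apply/polyP => i; rewrite coef_nderivn coefC coef_map; case: eqP => [->|i0].
      by rewrite addn0 binn.
    have -> : omega`_(j.+2 + i) = 0 by apply: nth_default; rewrite sw -[j.+3]addn1 leq_add2l lt0n; exact/eqP.
    by rewrite mul0rn.
  by rewrite hornerC.
have hE : expsum (shifted_phase omega al th N) N = expsum (fun n => 2 * pi * p.[n%:R]) N.
  by congr expsum; apply: funext => i; rewrite pE.
have hW := hC1 N N p N0 (leqnn _) sp; rewrite -hE in hW.
set E := expsum _ _ in hW *; have E0 : 0 <= E by exact: expsum_ge0.
set X := \sum_(1 <= m < (N ^ J).+1) kap N (m%:R * (J.+1`!%:R * p`_J.+1)).
have hX : X <= (2 * (A * N ^ J)%N%:R / q%:R + 1) * (2 + 4 * (q%:R / N%:R) * (1 + ln q.*2%:R)).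
  apply: le_trans (sum_kap_le (A * N ^ J) q0 N0 aq ha).
  apply: le_trans (sum_kap_scaled_le N (N ^ J) al A0).
  rewrite le_eqVlt; apply/orP; left; apply/eqP; apply: eq_bigr => m _.
  rewrite pj /A !natrM; have [w1|w1] := leP 0 w.
    by rewrite (_ : w%:~R = `|w|%N%:R) ?natr_absz ?ger0_norm //; congr kap; ring.
  rewrite -kapN (_ : w%:~R = - `|w|%N%:R).
    by congr kap; ring.
  by rewrite natr_absz ltr0_norm // intrN opprK.
pose Y := N%:R `^ Q; have Y0 : 0 < Y by exact: powR_gt0.
have YN : Y <= N%:R by rewrite /Y ler1_powR.
pose L : R := 1 + ln q.*2%:R.
have L1 : 1 <= L by rewrite lerDl ln_ge0 // ler1n double_gt0.
have P1 : 1 <= N%:R `^ e' by rewrite -[leLHS](powRr0 N%:R) ler_powR // ltW.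
have NYd : N%:R `^ (j.+2%:R - Q) = N%:R ^+ j.+2 / Y.
  by rewrite powR_natD // powRN powR_mulrn.
have LK : L <= K * N%:R `^ e'.
  have h : ln q.*2%:R <= ln 4 + j.+2%:R * ln N%:R :> R.
    rewrite mulr_natl -lnXn //; have := exprn_gt0 j.+2 N1.
    move: (N%:R ^+ j.+2) NYd => Z NYZ Z0.
    rewrite -lnM ?posrE // ler_ln ?posrE ?mulr_gt0 ?ltr0n ?double_gt0 //.
    rewrite -muln2 natrM; apply: le_trans (ler_wpM2r _ qY) _ => //.
    have : Z / Y <= Z.
      rewrite ler_pdivrMr // ler_peMr ?(ltW Z0) //.
      by rewrite -[leLHS](powRr0 N%:R) ler_powR.
    by rewrite NYZ; lra.
  have := ln_nat_le_powR e'0 N0 => hln.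
  have := ler_wpM2l (ler0n R j.+2) hln; rewrite mulrA => hj.
  rewrite /L /K mulrDl; apply: le_trans (lerD (lexx 1) (le_trans h (lerD (lexx _) hj))) _.
  by rewrite addrA lerD2r ler_peMr ?addr_ge0.
set P := N%:R `^ e' in P1 LK *; have P0 : 0 <= P by rewrite (le_trans _ P1).
have Yi0 : 0 <= Y^-1 by rewrite invr_ge0 ltW.
have NiY : N%:R^-1 <= Y^-1 by rewrite lef_pV2.
have NJi : N%:R ^- J <= Y^-1.
  by apply: le_trans NiY; rewrite lef_pV2 ?posrE ?exprn_gt0 // exprS ler_peMr ?exprn_ege1.
have qi : q%:R^-1 <= Y^-1 by rewrite lef_pV2.
have qN : q%:R / N%:R ^+ J.+1 <= 2 / Y.
  by rewrite ler_pdivrMr ?exprn_gt0 // mulrAC -mulrA -NYd.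
(* The four terms contribute 4 A, 8 A, 2 and 8, the last with the 2 from q <= 2 N^(d-Q); L >= 1
   makes them uniform. *)
have hB : N%:R ^- J * X <= (12 * A%:R + 10) * L / Y.
  have NJ0 : 0 <= N%:R ^- J :> R by rewrite invr_ge0 exprn_ge0.
  apply: le_trans (ler_wpM2l NJ0 hX) _.
  have -> : N%:R ^- J * ((2 * (A * N ^ J)%N%:R / q%:R + 1) *
        (2 + 4 * (q%:R / N%:R) * (1 + ln q.*2%:R))) =
      4 * A%:R * q%:R^-1 + 8 * A%:R * L * N%:R^-1 + 2 * N%:R ^- J + 4 * L * (q%:R / N%:R ^+ J.+1).
    rewrite /L natrM natrX exprS; move: (N%:R ^+ J) (exprn_gt0 J N1) (ln _) => NJ NJp l.
    by field; rewrite !gt_eqF.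
  have h1 := ler_wpM2l (mulr_ge0 (ler0n R 4) A1) qi.
  have h2 := ler_wpM2l (mulr_ge0 (mulr_ge0 (ler0n R 8) A1) (le_trans ler01 L1)) NiY.
  have h3 := ler_wpM2l (mulr_ge0 (ler0n R 4) (le_trans ler01 L1)) qN.
  have h4 : 4 * A%:R * Y^-1 <= 4 * A%:R * L * Y^-1.
    by rewrite ler_wpM2r // ler_peMr // mulr_ge0.
  have h5 : Y^-1 <= L * Y^-1 by rewrite ler_peMl.
  rewrite (_ : (12 * A%:R + 10) * L / Y =
    4 * A%:R * L * Y^-1 + 8 * A%:R * L * Y^-1 + 2 * (L * Y^-1) + 4 * L * (2 / Y)); last by ring.
  lra.
have hpow : (E / N%:R) ^+ (2 ^ J) <= C4 * (P * P / Y).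
  apply: le_trans hW _; rewrite /C4 -mulrA ler_wpM2l //.
  have hm : weyl_mean J N (J.+1`!%:R * p`_J.+1) <= D * ((12 * A%:R + 10) * K) * (P * P / Y).
    apply: le_trans (hD _ _ N0) _; rewrite -/P -/X.
    have -> : D * P / N%:R ^+ J * X = D * P * (N%:R ^- J * X) by rewrite mulrA.
    have DP : 0 <= D * P by rewrite mulr_ge0.
    apply: le_trans (ler_wpM2l DP hB) _.
    have -> : D * ((12 * A%:R + 10) * K) * (P * P / Y) = D * P * ((12 * A%:R + 10) * (K * P) / Y).
      by ring.
    rewrite ler_wpM2l // ler_wpM2r // ler_wpM2l // addr_ge0 // mulr_ge0 //.
  rewrite mulrDl mul1r; apply: lerD => //; apply: le_trans NiY _.
  by rewrite ler_peMl // mulr_ege1.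
have -> : 1 - s + e = 1 + (e - s) by ring.
rewrite powR_natD // powRr1 // mulrCA mulrC -ler_pdivrMr //.
have T0 : 0 <= (1 + C4) * N%:R `^ (e - s) by rewrite mulr_ge0 ?powR_ge0 ?addr_ge0.
rewrite -(@ler_pXn2r _ (2 ^ J)) ?expn_gt0 ?nnegrE ?divr_ge0 //.
apply: le_trans hpow _; rewrite exprMn.
have -> : (N%:R `^ (e - s)) ^+ (2 ^ J) = P * P / Y.
  rewrite -powR_mulrn ?powR_ge0 // -powRrM /P /Y -powR_natD // -powRN -powR_natD //.
  by congr (_ `^ _); rewrite Qs /e' /J natrX; field.
rewrite ler_wpM2r ?mulr_ge0 //; apply: (@le_trans _ _ (1 + C4)); first by rewrite lerDr.
by rewrite -[leLHS]expr1 ler_weXn2l ?lerDl // expn_gt0.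
Qed.

End MinorArcs.

(** * Small denominators for a generic [c] *)

Section MajorArcsGenericPoint.
Variable R : realType.

Lemma resonance_free_le (omega : {poly int}) (j k l : nat) (Q e c del : R) :
  (0 < k)%N -> (0 < l)%N -> (size omega <= j.+3)%N -> 0 <= Q -> Q <= 1 -> 0 < e -> 0 < del ->
  (forall (q : nat) (b : int), (0 < q)%N ->
      del / q%:R `^ (1 + e) <= `|q%:R * (l%:R / (2 * pi) * c) - b%:~R|) ->
  exists2 C : R, 0 <= C & forall (N q H : nat) (a : int) (al th : R), (0 < N)%N ->
  (0 < q)%N -> (0 < H)%N -> `|al - a%:~R / q%:R| <= (q%:R * H%:R)^-1 ->
  q%:R <= N%:R `^ Q -> N%:R `^ (j.+2%:R - Q) <= H%:R ->
  k%:R * th = l%:R * (c / (2 * pi) - al) ->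
  expsum (shifted_phase omega al th N) N <= C * N%:R `^ (2 * Q + e).
Proof.
move=> k0 l0 sw Q0 Q1 e0 d0 hc; have [C1 C10 hC1] := @major_arc_le R omega j sw.
have tp0 : 0 < 2 * pi :> R by rewrite mulr_gt0 ?pi_gt0.
have k1 : 0 < k%:R :> R by rewrite ltr0n.
have l1 : 0 < l%:R :> R by rewrite ltr0n.
have Ca0 : 0 <= 4 * k%:R / del * (1 + C1) by rewrite mulr_ge0 ?addr_ge0 ?divr_ge0 ?mulr_ge0 // ltW.
have Cb0 : 0 <= 2 * l%:R / del by rewrite divr_ge0 ?mulr_ge0 // ltW.
exists (4 * k%:R / del * (1 + C1) + 2 * l%:R / del); first exact: addr_ge0.
move=> N q H a al th N0 q0 H0 ha qY YH hth.
have N1 : 0 < N%:R :> R by rewrite ltr0n.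
have Nge1 : 1 <= N%:R :> R by rewrite ler1n.
have q1 : 0 < q%:R :> R by rewrite ltr0n.
have H1 : 0 < H%:R :> R by rewrite ltr0n.
pose Y := N%:R `^ Q; have Y0 : 0 < Y by exact: powR_gt0.
rewrite -/Y in qY.
have Yge1 : 1 <= Y by rewrite -[leLHS](powRr0 N%:R) ler_powR.
pose be := al - a%:~R / q%:R.
have hbe : q%:R * `|be| <= H%:R^-1.
  by rewrite mulrC -ler_pdivlMr // mulrC -invfM.
pose Z := q%:R `^ (1 + e); have Z0 : 0 < Z by exact: powR_gt0.
have ZY : Z <= Y `^ (1 + e).
  by apply: ge0_ler_powR; rewrite ?nnegrE ?(ltW Y0) // addr_ge0 // ltW.
have YQ : Y * Y `^ (1 + e) <= N%:R `^ (2 * Q + e).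
  rewrite /Y -powRrM -powR_natD // ler_powR //.
  have : Q * e <= e by rewrite ler_piMl // ltW.
  lra.
(* Multiplying by k turns q th - b into q l c / (2 pi) minus the integer l a + k b, up to the error
   l q be. *)
have dist (b : int) : del / Z - l%:R / H%:R <= k%:R * `|q%:R * th - b%:~R|.
  rewrite -[k%:R in leRHS](gtr0_norm k1) -normrM.
  have -> : k%:R * (q%:R * th - b%:~R) = (q%:R * (l%:R / (2 * pi) * c) - (l%:Z * a + k%:Z * b)%:~R)
      - l%:R * (q%:R * be).
    rewrite (_ : k%:R * (q%:R * th - b%:~R) = q%:R * (k%:R * th) - k%:R * b%:~R); last by ring.
    rewrite hth intrD !intrM -!pmulrn /be.
    move: (2 * pi : R) tp0 => T T0; field; rewrite ?gt_eqF //.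
  apply: le_trans (lerB_dist _ _); apply: lerB; first exact: hc.
  by rewrite normrM (gtr0_norm l1) normrM (gtr0_norm q1) ler_wpM2l // ltW.
(* Either the error takes at most half of the Diophantine distance, or H < 2 l Z / del; then N <=
   N^d <= Y H is already small enough for the trivial bound. *)
have [hl|hl] := leP (l%:R / H%:R) (del / Z / 2).
  have eta0 : 0 < del / Z / (2 * k%:R) by rewrite !divr_gt0 ?mulr_gt0.
  have heta : del / Z / (2 * k%:R) <= normc (1 - expi (2 * pi * (q%:R * th))).
    apply: normc_1Bexpi_ge => b; rewrite invfM mulrA ler_pdivrMr // [leRHS]mulrC.
    by apply: le_trans (dist b); lra.
  have := hC1 N q a be th _ N0 q0 eta0 heta.
  rewrite (_ : a%:~R / q%:R + be = al); last by rewrite /be addrC subrK.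
  move/le_trans; apply.
  have -> : 2 * q%:R / (del / Z / (2 * k%:R)) * (1 + C1 * `|be| * N%:R ^+ j.+2) =
     4 * k%:R / del * (Z * (q%:R + C1 * (q%:R * `|be| * N%:R ^+ j.+2))).
    by field; rewrite !gt_eqF.
  apply: (@le_trans _ _ (4 * k%:R / del * (1 + C1) * N%:R `^ (2 * Q + e))); last first.
    by rewrite ler_wpM2r ?powR_ge0 // lerDl.
  rewrite -[leRHS]mulrA ler_wpM2l ?divr_ge0 ?mulr_ge0 ?(ltW d0) //.
  apply: (@le_trans _ _ ((1 + C1) * (Y * Y `^ (1 + e)))); last first.
    by rewrite ler_wpM2l // addr_ge0.
  rewrite mulrA [leRHS]mulrC ler_pM ?(ltW Z0) //.
    have Np := exprn_ge0 j.+2 (ltW N1).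
    exact: addr_ge0 (ler0n _ _) (mulr_ge0 C10 (mulr_ge0 (mulr_ge0 (ler0n _ _) (normr_ge0 _)) Np)).
  (* The Abel loss: q |be| N^d <= N^d / H <= N^Q. *)
  rewrite mulrDl mul1r; apply: lerD => //; rewrite ler_wpM2l //.
  apply: le_trans (ler_wpM2r _ hbe) _; first by rewrite exprn_ge0.
  rewrite mulrC ler_pdivrMr //; apply: le_trans (ler_wpM2l (ltW Y0) YH).
  by rewrite /Y -powR_natD // addrC subrK powR_mulrn.
apply: le_trans (expsum_le _ _) _.
apply: (@le_trans _ _ (2 * l%:R / del * N%:R `^ (2 * Q + e))); last first.
  by rewrite ler_wpM2r ?powR_ge0 // lerDr.
have hH : H%:R <= 2 * l%:R / del * Y `^ (1 + e).
  have : H%:R * del <= 2 * l%:R * Z.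
    move: hl; rewrite ltr_pdivlMr // (_ : del / Z / 2 * H%:R = (H%:R * del) / (2 * Z)).
      by rewrite ltr_pdivrMr ?mulr_gt0 // => /ltW; rewrite mulrCA mulrA.
    by field; rewrite !gt_eqF.
  rewrite -ler_pdivlMr // => /le_trans; apply.
  by rewrite mulrAC ler_wpM2l.
apply: (@le_trans _ _ (Y * H%:R)); last first.
  apply: le_trans (ler_wpM2l (ltW Y0) hH) _.
  by rewrite mulrCA ler_wpM2l.
apply: le_trans (ler_wpM2l (ltW Y0) YH).
rewrite /Y -powR_natD // addrC subrK powR_mulrn // -[leLHS]expr1.
by rewrite ler_weXn2l.
Qed.

End MajorArcsGenericPoint.

(** * Choice of parameters and conclusion *)

Unset Implicit Arguments.
Theorem proposition3p3 (R : realType) (k l : nat) (hk : (0 < k)%N)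
    (hl : (0 < l)%N) (hkl : coprime k l)
    (d : nat) (hd : (2 <= d)%N)
    (omega : {poly int}) (hdeg : size omega = d.+1) :
  {ae (@lebesgue_measure R), forall c : R,
    lesssim_plus (fun N : nat => sup_norm (dyadic_sum k l omega c N))
      (1 - 1 / (2 ^+ d + 1))}.
Proof.
have tp0 : 0 < 2 * pi :> R by rewrite mulr_gt0 ?pi_gt0.
have k1 : 0 < k%:R :> R by rewrite ltr0n.
have l1 : 0 < l%:R :> R by rewrite ltr0n.
have lam0 : 0 < l%:R / (2 * pi) :> R by rewrite divr_gt0 // mulr_gt0.
case: d hd hdeg => [|[|j]] // _ sw.
have := ae_Diophantine lam0; apply: negligibleS => c; apply: contra_not => /= hc e e0.
set s : R := 1 / (2 ^+ j.+2 + 1).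
have p0 : 0 < 2 ^+ j.+2 + 1 :> R by rewrite addr_gt0 ?exprn_gt0.
pose Q : R := 2 ^+ j.+1 * s.
have Q0 : 0 <= Q by rewrite mulr_ge0 ?exprn_ge0 // divr_ge0 // ltW.
have Qs : 2 * Q = 1 - s.
  by rewrite /Q mulrA -exprS /s; field; rewrite gt_eqF.
have s0 : 0 < s by rewrite divr_gt0.
have Q1 : Q <= 1 by lra.
have [del d0 hdel] := hc e e0.
have [C1 C10 hC1] := minor_arc_le sw Q0 Q1 (erefl Q) e0.
have sw' : (size omega <= j.+3)%N by rewrite sw.
have [C2 C20 hC2] := resonance_free_le hk hl sw' Q0 Q1 e0 d0 hdel.
(* Both constants were fixed before [x] and [N], so the bound passes to the supremum. *)
exists (C1 + C2) => N N0; apply: ub_ereal_sup => _ [x _ <-]; rewrite lee_fin.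
have N1 : 0 < N%:R :> R by rewrite ltr0n.
pose al := (c - k%:R / l%:R * x) / (2 * pi); pose th := x / (2 * pi).
have -> : normc (dyadic_sum k l omega c N x) = expsum (shifted_phase omega al th N) N.
  rewrite /dyadic_sum /expsum -{1}[N]add0n big_addn (_ : 2 * N - N = N)%N; last by lia.
  congr normc; apply: eq_bigr => i _; rewrite addnC; congr expi.
  by rewrite /shifted_phase /al /th; move: (2 * pi : R) tp0 => T T0; field; rewrite !gt_eqF.
(* Rounding up gives H >= N^(d-Q) for small q; as N^(d-Q) >= 1, also H <= 2 N^(d-Q), as needed for
   large q. *)
pose H := (Num.truncn (N%:R `^ (j.+2%:R - Q))).+1.
have HY : N%:R `^ (j.+2%:R - Q) <= H%:R by rewrite ltW // truncnS_gt.
have H2 : H%:R <= 2 * N%:R `^ (j.+2%:R - Q).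
  have T1 : 1 <= N%:R `^ (j.+2%:R - Q).
    by rewrite -[leLHS](powRr0 N%:R) ler_powR ?ler1n // subr_ge0 (le_trans Q1) // ler1n.
  have /andP[h _] := truncn_itv (powR_ge0 N%:R (j.+2%:R - Q)).
  by rewrite /H -natr1; lra.
have [a [q [/andP[q0 qH] aq ha]]] := @Dirichlet_approximation R al H (ltn0Sn _).
have q1 : 0 < q%:R :> R by rewrite ltr0n.
have [hq|hq] := leP (N%:R `^ Q) q%:R.
  apply: (@le_trans _ _ (C1 * N%:R `^ (1 - s + e))).
    apply: (hC1 N q a) => //; last by apply: le_trans H2; rewrite ler_nat.
    apply: le_trans ha _; rewrite lef_pV2 ?posrE ?mulr_gt0 ?exprn_gt0 // ?ltr0n //.
    by rewrite expr2 ler_wpM2l // ler_nat.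
  by rewrite ler_wpM2r ?powR_ge0 // lerDl.
apply: (@le_trans _ _ (C2 * N%:R `^ (1 - s + e))).
  rewrite -Qs; apply: (hC2 N q H a) => //; first exact: ltW.
  by rewrite /th /al; move: (2 * pi : R) tp0 => T T0; field; rewrite !gt_eqF.
by rewrite ler_wpM2r ?powR_ge0 // lerDr.
Qed.
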